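(* Let $M=mq$ and let $Y_r=([X_{r,1}],\dots,[X_{r,q}])$, with $X_{r,s}\in\mathbb{R}^{m+1}$, $\|X_{r,s}\|=1$, $s=1,\dots,q$, $r=1,\dots,n$, be a random sample from a probability measure $Q$ on $(\mathbb{R}P^m)^q$. For $s=1,\dots,q$, let $\lambda_s(a)$ and $\gamma_s(a)$, $a=1,\dots,m+1$, be the eigenvalues in increasing order and corresponding unit eigenvectors of $E[X_{1,s}X_{1,s}^T]$. If $\lambda_s(m+1)>0$, $s=1,\dots,q$, are simple, then the statistic $$T^2(Y;Q)=n\,(\gamma_1^TD_1,\dots,\gamma_q^TD_q)\,G^{-1}\,(\gamma_1^TD_1,\dots,\gamma_q^TD_q)^T$$ converges weakly to $\chi^2_M$, the chi-square distribution with $M$ degrees of freedom (as $n\to\infty$).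
   Context: $\mathbb{R}P^m$ is the space of axes $[x]=\{\pm x\}$, $x\in\mathbb{R}^{m+1}$, $\|x\|=1$, and $q\ge1$. The space $(\mathbb{R}P^m)^q$ is embedded in the $q$-fold product of the space of symmetric $(m+1)\times(m+1)$ matrices by $([x_1],\dots,[x_q])\mapsto(x_1x_1^T,\dots,x_qx_q^T)$, $\|x_s\|=1$. The extrinsic mean of $Q$ is the minimizer of the expected squared chord distance for this embedding (with the Euclidean norm $\|A\|^2=\operatorname{tr}AA^T$ on matrices); when the largest eigenvalue of each $E[X_{1,s}X_{1,s}^T]$ is simple, it exists and equals $\mu=([\gamma_1],\dots,[\gamma_q])$ with unit column vectors $\gamma_s=\gamma_s(m+1)$, $s=1,\dots,q$. These are the vectors $\gamma_s$ appearing in $T^2(Y;Q)$. For $s=1,\dots,q$ let $$J_s=\frac1n\sum_{r=1}^nX_{r,s}X_{r,s}^T,$$ and let $d_s(a)$ and $g_s(a)$, $a=1,\dots,m+1$, be the eigenvalues in increasing order and the corresponding unit eigenvectors of $J_s$. Let $D_s=(g_s(1),\dots,g_s(m))$, an $(m+1)\times m$ matrix. With the pairs of indices $(s,a)$, $s=1,\dots,q$, $a=1,\dots,m$, arranged in their lexicographic order, $G$ is the $M\times M$ symmetric matrix with entries $$G_{(s,a),(t,b)}=n^{-1}(d_s(m+1)-d_s(a))^{-1}(d_t(m+1)-d_t(b))^{-1}\sum_{r=1}^n(g_s(a)^TX_{r,s})(g_t(b)^TX_{r,t})(g_s(m+1)^TX_{r,s})(g_t(m+1)^TX_{r,t}).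$$
   Formalization: Two conditions are added: the population counterpart of G (the extrinsic covariance matrix) is invertible, and the signs of the top sample eigenvectors are chosen so that γ_s^T g_s(m+1) ≥ 0; without them G^{-1} may be undefined or the χ²_M limit false. *)

(* Defs.v *)
From HB Require Import structures.
From mathcomp Require Import all_boot all_order all_algebra.
From mathcomp Require Import all_classical all_reals all_analysis.
From mathcomp Require Import measurable_realfun.

Set Implicit Arguments.
Unset Strict Implicit.
Unset Printing Implicit Defensive.

Import Order.TTheory GRing.Theory Num.Theory.
Import numFieldNormedType.Exports.

Local Open Scope classical_set_scope.
Local Open Scope ring_scope.

(* The norm `|_| of MathComp-Analysis on matrices is the sup norm, hence the
   Euclidean structure of R^k is written with the dot product. *)
Definition dotv (R : realType) (k : nat) (u v : 'cV[R]_k) : R :=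
  (u^T *m v) ord0 ord0.

Definition unit_sphere (R : realType) (m : nat) : set 'cV[R]_m.+1 :=
  [set x | dotv x x = 1].

Definition axis (R : realType) (m : nat) (x : 'cV[R]_m.+1) : set 'cV[R]_m.+1 :=
  [set x; - x].

Definition projective_space (R : realType) (m : nat) : Type :=
  set_type (@axis R m @` @unit_sphere R m).

HB.instance Definition _ (R : realType) (m : nat) :=
  Choice.on (projective_space R m).

Lemma axis_point_subproof (R : realType) (m : nat) :
  axis (delta_mx ord0 ord0 : 'cV[R]_m.+1) \in @axis R m @` @unit_sphere R m.
Proof.
apply/mem_set; exists (delta_mx ord0 ord0) => //.
by rewrite /unit_sphere /= /dotv trmx_delta mul_delta_mx mxE !eqxx.
Qed.

HB.instance Definition _ (R : realType) (m : nat) :=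
  isPointed.Build (projective_space R m)
    (exist _ (axis (delta_mx ord0 ord0)) (axis_point_subproof R m)).

(* The embedding [x] |-> x x^T; it does not depend on the element of {x, -x}
   picked by xget. *)
Definition rp_embed (R : realType) (m : nat) (p : projective_space R m) :
    'M[R]_m.+1 :=
  let x := xget 0 (val p) in x *m x^T.

(* The open sets of RP^m are those induced by the embedding. *)
Definition rp_open (R : realType) (m : nat) : set (set (projective_space R m)) :=
  [set @rp_embed R m @^-1` V | V in [set V | open V]].

(* RP^m with its Borel sigma-algebra; (RP^m)^q is the type q.-tuple (RP R m),
   with the product sigma-algebra of the library. *)
Definition RP (R : realType) (m : nat) := g_sigma_algebraType (@rp_open R m).

Definition mutually_independent (d d' : measure_display) (R : realType)
    (Omega : measurableType d) (T : measurableType d') (P : probability Omega R)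
    (Y : nat -> {RV P >-> T}) : Prop :=
  forall (s : seq nat) (A : nat -> set T), uniq s ->
    (forall r, measurable (A r)) ->
    P (\big[setI/setT]_(r <- s) (Y r @^-1` A r)) =
    (\prod_(r <- s) P (Y r @^-1` A r))%E.

(* lam lists the eigenvalues of A with multiplicity, in increasing order, and v
   is a corresponding orthonormal family of eigenvectors. *)
Definition eigensystem (R : realType) (k : nat) (A : 'M[R]_k)
    (lam : 'I_k -> R) (v : 'I_k -> 'cV[R]_k) : Prop :=
  [/\ forall a b : 'I_k, (a <= b)%N -> lam a <= lam b,
      forall a b : 'I_k, dotv (v a) (v b) = (a == b)%:R &
      forall a : 'I_k, A *m v a = lam a *: v a].

Definition second_moment (d : measure_display) (R : realType)
    (Omega : measurableType d) (P : probability Omega R) (k : nat)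
    (V : Omega -> 'cV[R]_k) : 'M[R]_k :=
  \matrix_(i, j) fine 'E_P[(fun w => V w i ord0 * V w j ord0)%R]%E.

(* With 0-based indices the largest eigenvalue, number m+1, has index ord_max,
   and the indices a = 1, ..., m are the image of 'I_m in 'I_m.+1. *)
Definition low (m : nat) (a : 'I_m) : 'I_m.+1 := widen_ord (leqnSn m) a.

Section statistic.
Variables (R : realType) (m q n : nat).
Variable x : nat -> 'I_q -> 'cV[R]_m.+1.

(* J_s *)
Definition sample_moment (s : 'I_q) : 'M[R]_m.+1 :=
  n%:R^-1 *: \sum_(r < n) x r s *m (x r s)^T.

Variables (d : 'I_q -> 'I_m.+1 -> R) (g : 'I_q -> 'I_m.+1 -> 'cV[R]_m.+1).

(* D_s *)
Definition low_eigenvectors (s : 'I_q) : 'M[R]_(m.+1, m) :=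
  \matrix_(i, a) g s (low a) i ord0.

(* The matrix G: block (s, t), entry (a, b), is G_{(s,a),(t,b)}, so that pairs
   of indices are in lexicographic order; its size is \sum_(s < q) m = m q. *)
Definition Gmatrix : 'M[R]_(\sum_(s < q) m) :=
  \mxblock_(s < q, t < q) \matrix_(a < m, b < m)
    (n%:R^-1 * (d s ord_max - d s (low a))^-1
             * (d t ord_max - d t (low b))^-1
     * \sum_(r < n) dotv (g s (low a)) (x r s) * dotv (g t (low b)) (x r t)
                  * dotv (g s ord_max) (x r s) * dotv (g t ord_max) (x r t)).

Definition T2 (gam : 'I_q -> 'cV[R]_m.+1) : R :=
  let v := \mxrow_(s < q) ((gam s)^T *m low_eigenvectors s) in
  n%:R * (v *m invmx Gmatrix *m v^T) ord0 ord0.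

End statistic.

(* The extrinsic covariance matrix of the law of (V_1, ..., V_q): the matrix G
   with population eigenvalues, eigenvectors and expectation in place of the
   sample ones. *)
Definition extrinsic_cov (disp : measure_display) (R : realType)
    (Omega : measurableType disp) (P : probability Omega R) (m q : nat)
    (V : 'I_q -> Omega -> 'cV[R]_m.+1)
    (lam : 'I_q -> 'I_m.+1 -> R) (gam : 'I_q -> 'I_m.+1 -> 'cV[R]_m.+1) :
    'M[R]_(\sum_(s < q) m) :=
  \mxblock_(s < q, t < q) \matrix_(a < m, b < m)
    ((lam s ord_max - lam s (low a))^-1 * (lam t ord_max - lam t (low b))^-1
     * fine 'E_P[(fun w =>
           dotv (gam s (low a)) (V s w) * dotv (gam t (low b)) (V t w)
         * dotv (gam s ord_max) (V s w) * dotv (gam t ord_max) (V t w))%R]%E).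

(* The library's normal_prob is a measure on measurableTypeR R, an alias of R
   with the same (Borel) measurable sets but another display. *)
Definition add_sqr (R : realType) (z : R * measurableTypeR R) : R :=
  z.1 + (z.2 : R) ^+ 2.

Lemma measurable_add_sqr (R : realType) :
  measurable_fun [set: R * measurableTypeR R] (@add_sqr R).
Proof.
apply: measurable_funD; first exact: measurable_fst.
apply: measurable_funX => _ B mB; exact: measurable_snd.
Qed.

HB.instance Definition _ (R : realType) :=
  isMeasurableFun.Build _ _ _ _ (@add_sqr R) (@measurable_add_sqr R).

(* The law of Z_1^2 + ... + Z_k^2 for independent standard normal Z_i. *)
Fixpoint chi_square (R : realType) (k : nat) : probability R R :=
  if k is k'.+1
  then distribution (chi_square R k' \x normal_prob (0 : R) 1)%E (@add_sqr R)
  else \d_(0 : R).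

Definition cvg_in_law (d : measure_display) (R : realType)
    (Omega : measurableType d) (P : probability Omega R)
    (T : nat -> {RV P >-> R}) (mu : probability R R) : Prop :=
  forall f : R -> R, continuous f -> (exists B, forall t, `|f t| <= B) ->
    (\int[distribution P (T n)]_t (f t)%:E)%E @[n --> \oo]
      --> (\int[mu]_t (f t)%:E)%E.

(* Main.v *)
Require Import Defs.
From HB Require Import structures.
From mathcomp Require Import all_boot all_order all_algebra.
From mathcomp Require Import all_classical all_reals all_analysis.
From mathcomp Require Import measurable_realfun ring lra.

Set Implicit Arguments.
Unset Strict Implicit.
Unset Printing Implicit Defensive.

Import Order.TTheory GRing.Theory Num.Theory.
Import numFieldNormedType.Exports.

Local Open Scope classical_set_scope.
Local Open Scope ring_scope.

(** The statistic is, without any remainder term, a studentized mean.  Write [gam s]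
    and [g s] for the top eigenvectors, those of index [ord_max], of the population and
    of the sample moment matrix.  Multiplying the row vector and the matrix of the form by [frame], which
    expresses the low sample eigenvectors in the low population ones and carries the
    differences of sample eigenvalues, cancels those differences and turns

    - the row vector into minus the mean of the scores, the independent, bounded and
      centred vectors with entries [(gam s . X) (gam s a . X)] ([mean_frame]);
    - [G] into the mean of the outer squares of the scores in which [g s] replaces
      [gam s] and the low eigenvectors are made orthogonal to [g s] ([gram_frame]).

    The low sample eigenvectors, which may neither converge nor be unique, thereby
    disappear from the statistic ([T2_qform]).

    The top eigenvector does converge: it maximises the quadratic form of a matrix that
    is entrywise close to the population one, by the law of large numbers, and there
    every component orthogonal to [gam s] costs at least the spectral gap
    ([near_maximizer_close]).  Hence the transformed [G] converges in probability to the
    covariance [score_cov] of the scores, which is the extrinsic covariance without its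
    eigenvalue factors and is therefore invertible.  The statistic is then close in
    probability to [oracle], the same form with [score_cov] for the transformed [G]
    ([statistic_close_oracle]).

    The central limit theorem for [oracle] is proved through its Laplace transform, by
    Lindeberg's replacement with explicit functions.  For a Gaussian
    [exp (- t Q)], where [Q] is the form of the inverse covariance in [N] variables,
    adding one more term to the sum changes the mean as adding a normal vector would, up
    to [O (t ^ (3/2))]; for a normal vector the change is exactly a factor
    [(1 + 2 t) ^ (- N / 2)] and the replacement of [t] by [t / (1 + 2 t)].  After [n]
    steps from [t / n] the factors multiply to [(1 + 2 t) ^ (- N / 2)] ([laplace_clt]),
    the Laplace transform of the chi-square law ([chi_square_laplace]).  Finally, Laplace
    transforms of nonnegative variables determine convergence in law, by Weierstrass
    approximation in the variable [exp (- x)] ([laplace_determines_law]). *)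

(** * Taylor bounds for the exponential *)

Lemma increment_le (R : realType) (F f : R -> R) (K y : R) :
  (forall x : R, is_derive x (1 : R) F (f x)) ->
  (forall c, `|c| <= `|y| -> 0 <= c * y -> `|f c| <= K) ->
  `|F y - F 0| <= K * `|y|.
Proof.
move=> dF fK.
have cF a b : {within `[a, b], continuous F}.
  by apply: derivable_within_continuous => x _; have [] := dF x.
have [y0|y0|->] := ltgtP y 0; last by rewrite subrr !normr0 mulr0.
- have [c] := MVT y0 (fun x _ => dF x) (cF y 0).
  rewrite in_itv /= => /andP[yc c0]; rewrite distrC => ->.
  rewrite sub0r normrM normrN ler_wpM2r// fK//.
    by rewrite !ler0_norm ?lerN2 ?ltW.
  by rewrite nmulr_rge0 ?ltW.
- have [c] := MVT y0 (fun x _ => dF x) (cF 0 y).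
  rewrite in_itv /= => /andP[c0 cy] ->.
  rewrite subr0 normrM ler_wpM2r// fK//.
    by rewrite !ger0_norm ?ltW.
  by rewrite mulr_ge0 ?ltW.
Qed.

(** The factor [1 + expR c] bounds the exponential between 0 and [c] whatever the sign of
    [c], which need not be known when the bound is multiplied by another exponential. *)
Lemma expR_taylor0 (R : realType) (c : R) : `|expR c - 1| <= `|c| * (1 + expR c).
Proof.
have e0 := expR_ge0 c.
have h1 := expR_ge1Dx c.
have h2 : expR c - 1 <= c * expR c.
  have := expR_ge1Dx (- c); rewrite expRN => h.
  have : (1 - c) * expR c <= 1.
    by apply: le_trans (ler_wpM2r e0 h) _; rewrite mulVf// gt_eqF// expR_gt0.
  by lra.
rewrite ler_norml; have [c0|c0] := leP 0 c.
  rewrite (ger0_norm c0).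
  have : 0 <= c * expR c by rewrite mulr_ge0.
  by move=> ?; apply/andP; split; nra.
rewrite (ltr0_norm c0).
have : expR c <= 1 by rewrite expR_le1 ltW.
by move=> ?; apply/andP; split; nra.
Qed.

Lemma le_expR_same_side (R : realType) (c y : R) : `|c| <= `|y| -> 0 <= c * y ->
  1 + expR c <= 2 * (1 + expR y).
Proof.
move=> cy c0.
have e0 := expR_ge0 y.
have [y0|y0] := leP 0 y.
  have : expR c <= expR y.
    by rewrite ler_expR (le_trans (ler_norm c))// (le_trans cy)// ger0_norm.
  by lra.
have : expR c <= 1.
  by rewrite expR_le1; rewrite nmulr_lge0 in c0.
by lra.
Qed.

Lemma expR_taylor1 (R : realType) (y : R) :
  `|expR y - 1 - y| <= 2 * `|y| ^+ 2 * (1 + expR y).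
Proof.
pose F (x : R) := expR x - x.
have dF x : is_derive x (1 : R) F (expR x - 1).
  by rewrite /F; apply: is_deriveB.
have := @increment_le R F (fun x => expR x - 1) (2 * `|y| * (1 + expR y)) y dF.
rewrite /F expR0 subr0 addrAC expr2 => H.
rewrite (_ : 2 * (`|y| * `|y|) * _ = 2 * `|y| * (1 + expR y) * `|y|); last by ring.
apply: H => c cy c0; apply: (le_trans (expR_taylor0 c)).
rewrite mulrAC mulrC; apply: ler_pM => //; last exact: le_expR_same_side.
Qed.

Lemma expR_taylor2 (R : realType) (y : R) :
  `|expR y - 1 - y - y ^+ 2 / 2| <= 4 * `|y| ^+ 3 * (1 + expR y).
Proof.
pose F (x : R) := expR x - x - x ^+ 2 / 2.
have dF x : is_derive x (1 : R) F (expR x - 1 - x).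
  rewrite /F; apply: is_deriveB.
  apply: is_derive_eq.
  by rewrite !scaler0 add0r /GRing.scale /=; lra.
have := @increment_le R F _ (4 * `|y| ^+ 2 * (1 + expR y)) y dF.
rewrite /F expR0 subr0 expr0n/= mul0r subr0 => H.
rewrite (_ : 4 * _ * _ = 4 * `|y| ^+ 2 * (1 + expR y) * `|y|); last by ring.
rewrite (_ : _ - 1 - y - _ = expR y - y - y ^+ 2 / 2 - 1); last by ring.
apply: H => c cy c0; apply: (le_trans (expR_taylor1 c)).
rewrite (_ : 4 * _ * _ = 2 * `|y| ^+ 2 * (2 * (1 + expR y))); last by ring.
apply: ler_pM => //.
- by rewrite ler_pM2l// lerXn2r ?nnegrE.
- exact: le_expR_same_side.
Qed.

(** From [1 + v / 3 <= expR (v / 3)]. *)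
Lemma cube_expR_le (R : realType) (v : R) : 0 <= v -> (2 + v) ^+ 3 * expR (- v) <= 27.
Proof.
move=> v0; rewrite expRN -ler_pdivlMr ?invr_gt0 ?expR_gt0// invrK.
have -> : v = 3 * (v / 3) by field.
rewrite (expRM_natl 3).
apply: (@le_trans _ _ (27 * (1 + v / 3) ^+ 3)).
  have -> : 27 * (1 + v / 3) ^+ 3 = (3 * (1 + v / 3)) ^+ 3 by ring.
  by rewrite lerXn2r ?nnegrE; lra.
by rewrite ler_pM2l// lerXn2r ?nnegrE ?expR_ge0 ?expR_ge1Dx//; lra.
Qed.

Lemma poly_expR_le (R : realType) (v p : R) :
  0 <= v -> p <= (2 + v) ^+ 3 -> p * expR (- v) <= 27.
Proof.
by move=> v0 pv; apply: le_trans (cube_expR_le v0); rewrite ler_wpM2r// expR_ge0.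
Qed.

(** The increment [2 b + e ^+ 2] of a quadratic form [v] along a step of form [e ^+ 2];
    the hypothesis on [b] is the Cauchy-Schwarz inequality. *)
Lemma quad_increment_le (R : realType) (v b e : R) :
  0 <= v -> 0 <= e <= 1 -> b ^+ 2 <= v * e ^+ 2 ->
  `|2 * b| <= (1 + v) * e /\ `|2 * b + e ^+ 2| <= (2 + v) * e.
Proof.
move=> v0 /andP[e0 e1] be.
have h : `|2 * b| <= (1 + v) * e.
  rewrite -(@ler_pXn2r _ 2)// ?nnegrE ?normr_ge0 ?mulr_ge0//; last by lra.
  rewrite real_normK ?num_real// !exprMn.
  have : 0 <= ((1 - v) * e) ^+ 2 by rewrite sqr_ge0.
  by rewrite exprMn; nra.
split=> //; apply: (le_trans (ler_normD _ _)).
rewrite [`|e ^+ 2|]ger0_norm ?sqr_ge0//.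
have : e ^+ 2 <= e by rewrite expr2; nra.
by lra.
Qed.

(** The Taylor polynomial of order two, in the step, of the Gaussian of a quadratic form
    whose values before and after the step are [v0] and [v1].  The error is uniform in
    [v0], since the increment is at most [(2 + v0) * e] and also at most [(2 + v1) * e], and
    either Gaussian absorbs the cube of the corresponding factor. *)
Lemma gauss_increment (R : realType) (v0 v1 b e : R) :
  0 <= v0 -> 0 <= v1 -> 0 <= e <= 1 -> v1 = v0 + 2 * b + e ^+ 2 ->
  b ^+ 2 <= v0 * e ^+ 2 ->
  `|expR (- v1) - expR (- v0) * (1 - 2 * b - e ^+ 2 + 2 * b ^+ 2)| <= 244 * e ^+ 3.
Proof.
move=> v00 v10 e01 v1E be.
have /andP[e0 e1] := e01.
pose y := v0 - v1.
have E0 := expR_ge0 (- v0).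
have [hb hy0] := quad_increment_le v00 e01 be.
have hy1 : `|2 * (- b - e ^+ 2) + e ^+ 2| <= (2 + v1) * e.
  suff /(quad_increment_le v10 e01)[] : (- b - e ^+ 2) ^+ 2 <= v1 * e ^+ 2 by [].
  by rewrite v1E; nra.
have yE0 : `|y| <= (2 + v0) * e 
  by rewrite (_ : y = - (2 * b + e ^+ 2)) ?normrN// /y; lra.
have yE1 : `|y| <= (2 + v1) * e 
  by rewrite (_ : y = 2 * (- b - e ^+ 2) + e ^+ 2)// /y; lra.
have main (v : R) : 0 <= v -> `|y| <= (2 + v) * e -> `|y| ^+ 3 * expR (- v) <= 27 * e ^+ 3.
  move=> v_ge0 hy; apply: (@le_trans _ _ (((2 + v) ^+ 3 * expR (- v)) * e ^+ 3)).
    rewrite [leRHS]mulrAC -exprMn ler_wpM2r ?expR_ge0// lerXn2r ?nnegrE//.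
    by rewrite mulr_ge0//; lra.
  by rewrite ler_wpM2r ?exprn_ge0// cube_expR_le.
have -> : expR (- v1) = expR (- v0) * expR y.
  by rewrite -expRD; congr expR; rewrite /y; ring.
have -> : expR (- v0) * expR y - expR (- v0) * (1 - 2 * b - e ^+ 2 + 2 * b ^+ 2) =
    expR (- v0) * (expR y - 1 - y - y ^+ 2 / 2) +
    expR (- v0) * (2 * b * e ^+ 2 + e ^+ 4 / 2).
  by rewrite /y v1E; field.
apply: (le_trans (ler_normD _ _)).
rewrite !normrM (ger0_norm E0).
have h1 : expR (- v0) * `|expR y - 1 - y - y ^+ 2 / 2| <= 216 * e ^+ 3.
  apply: (le_trans (ler_wpM2l E0 (expR_taylor2 y))).
  have -> : expR (- v0) * (4 * `|y| ^+ 3 * (1 + expR y)) =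
     4 * (`|y| ^+ 3 * expR (- v0) + `|y| ^+ 3 * expR (- v1)).
    have -> : expR (- v1) = expR (- v0) * expR y.
      by rewrite -expRD; congr expR; rewrite /y; ring.
    by ring.
  by have := main _ v00 yE0; have := main _ v10 yE1; lra.
have h2 : expR (- v0) * `|2 * b * e ^+ 2 + e ^+ 4 / 2| <= 27 * e ^+ 3.
  have : `|2 * b * e ^+ 2 + e ^+ 4 / 2| <= (2 + v0) * e ^+ 3.
    apply: (le_trans (ler_normD _ _)); rewrite normrM.
    rewrite (ger0_norm (exprn_ge0 2 e0)) [`|e ^+ 4 / 2|]ger0_norm ?divr_ge0 ?exprn_ge0//.
    have : `|2 * b| * e ^+ 2 <= (1 + v0) * e ^+ 3.
      have -> : (1 + v0) * e ^+ 3 = (1 + v0) * e * e ^+ 2 by ring.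
      by rewrite ler_wpM2r ?sqr_ge0.
    have : e ^+ 4 <= e ^+ 3 by rewrite (exprSr e 3) ler_piMr ?exprn_ge0.
    have := exprn_ge0 3 e0.
    by lra.
  move=> /(ler_wpM2l E0)/le_trans; apply.
  rewrite mulrA ler_wpM2r ?exprn_ge0// mulrC poly_expR_le//.
  by rewrite exprS; nra.
by have := exprn_ge0 3 e0; lra.
Qed.

(** * Normalising factors of Gaussians *)

(** The Laplace transform of the square of a standard normal variable. *)
Definition chi_factor (R : realType) (t : R) : R := (Num.sqrt (1 + 2 * t))^-1.

Section chi_factor.
Context {R : realType}.
Implicit Types t : R.

Lemma chi_factor_gt0 t : 0 <= t -> 0 < chi_factor t.
Proof. by move=> t0; rewrite invr_gt0 sqrtr_gt0; lra. Qed.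

Lemma chi_factor_sqr t : 0 <= t -> chi_factor t ^+ 2 * (1 + 2 * t) = 1.
Proof.
move=> t0; rewrite exprVn sqr_sqrtr ?mulVf//; last by lra.
by rewrite gt_eqF//; lra.
Qed.

Lemma chi_factor_le1 t : 0 <= t -> chi_factor t <= 1.
Proof.
move=> t0; have := chi_factor_sqr t0; have := chi_factor_gt0 t0.
move=> c0 cE; rewrite leNgt; apply/negP => c1.
by have : 1 < chi_factor t ^+ 2 by [rewrite exprn_egt1]; nra.
Qed.

(** The variance of a sum of independent normal variables is the sum of the variances:
    [t] is replaced by [t / (1 + 2 * t)] after a first term has been integrated out. *)
Lemma chi_factorM t u : 0 <= t -> 0 <= u ->
  chi_factor t * chi_factor (u / (1 + 2 * t)) = chi_factor (u + t).
Proof.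
move=> t0 u0; rewrite /chi_factor -invfM -sqrtrM; last by lra.
by congr (Num.sqrt _)^-1; field; lra.
Qed.

Lemma chi_factor_approx t : 0 <= t <= 1 -> `|chi_factor t - (1 - t)| <= 6 * t ^+ 2.
Proof.
move=> /andP[t0 t1].
have := chi_factor_sqr t0; have := chi_factor_gt0 t0; have := chi_factor_le1 t0.
set c := chi_factor t => c1 c0 cE.
have c2 : 1 / 2 <= c.
  rewrite leNgt; apply/negP => c2.
  have : c ^+ 2 < 1 / 4 by rewrite expr2; nra.
  by nra.
have h : `|c - (1 - t)| * (c + (1 - t)) <= 3 * t ^+ 2.
  rewrite -[X in _ * X <= _]ger0_norm; last by lra.
  rewrite -normrM ler_norml; apply/andP; split.
    have -> : (c - (1 - t)) * (c + (1 - t)) = c ^+ 2 - (1 - t) ^+ 2 by ring.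
    have : (1 - t) ^+ 2 * (1 + 2 * t) <= 1 by rewrite expr2; nra.
    have := sqr_ge0 t.
    move=> ? h; have : ((1 - t) ^+ 2 - c ^+ 2) * (1 + 2 * t) <= 0 by nra.
    by nra.
  have -> : (c - (1 - t)) * (c + (1 - t)) = c ^+ 2 - (1 - t) ^+ 2 by ring.
  have : (c ^+ 2 - (1 - t) ^+ 2) * (1 + 2 * t) = t ^+ 2 * (3 - 2 * t).
    by rewrite mulrBl cE; ring.
  have := sqr_ge0 t => ? h.
  have : (c ^+ 2 - (1 - t) ^+ 2) * (1 + 2 * t) <= 3 * t ^+ 2 * (1 + 2 * t) by nra.
  by rewrite ler_pM2r//; lra.
have : `|c - (1 - t)| * (1 / 2) <= `|c - (1 - t)| * (c + (1 - t)).
  by rewrite ler_wpM2l//; lra.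
by lra.
Qed.

Lemma chi_factorX_approx (N : nat) : exists2 C : R, 0 <= C &
  forall t, 0 <= t <= 1 -> `|chi_factor t ^+ N - (1 - N%:R * t)| <= C * t ^+ 2.
Proof.
elim: N => [|N [C C0 IH]].
  exists 0 => // t _; rewrite expr0 mul0r subr0 subrr normr0; lra.
exists (C + 6 * (1 + N%:R) + N%:R).
  by have := ler0n R N; lra.
move=> t t01; have /andP[t0 t1] := t01.
have N0 := ler0n R N.
have h1 := IH t t01; have h2 := chi_factor_approx t01.
have c0 := chi_factor_gt0 t0; have c1 := chi_factor_le1 t0.
set c := chi_factor t in h1 h2 c0 c1 *.
have -> : c ^+ N.+1 - (1 - N.+1%:R * t) = c * (c ^+ N - (1 - N%:R * t))
   + (c - (1 - t)) * (1 - N%:R * t) + N%:R * t ^+ 2.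
  by rewrite exprS -natr1; ring.
apply: (le_trans (ler_normD _ _)); apply: (@le_trans _ _
  (C * t ^+ 2 + 6 * t ^+ 2 * (1 + N%:R) + N%:R * t ^+ 2)); last by lra.
apply: lerD; last first.
  by rewrite ger0_norm// mulr_ge0// sqr_ge0.
apply: (le_trans (ler_normD _ _)); rewrite !normrM; apply: lerD.
  by rewrite (gtr0_norm c0) -[leRHS]mul1r; apply: ler_pM => //; exact: ltW.
apply: ler_pM => //; apply: (le_trans (ler_normB _ _)).
rewrite normr1 lerD2l normrM !ger0_norm//.
by rewrite ler_piMr.
Qed.

(** To first order in [t], the second-order expansion of the Gaussian with the moments of
    a step of covariance inverse to the form is what integrating out a normal step
    gives: a normalising factor and a flatter Gaussian. *)
Lemma gauss_rescaling_approx (N : nat) : exists2 C : R, 0 <= C &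
  forall t v : R, 0 <= t <= 1 -> 0 <= v ->
  `|expR (- v) * (1 - N%:R * t + 2 * t * v) -
    chi_factor t ^+ N * expR (- (v / (1 + 2 * t)))| <= C * t ^+ 2.
Proof.
have [C C0 HC] := chi_factorX_approx N.
have N0 := ler0n R N.
exists (540 + 27 * C + 54 * N%:R); first by lra.
move=> t v t01 v0; have /andP[t0 t1] := t01.
have h := HC t t01.
have c0 := chi_factor_gt0 t0; have c1 := chi_factor_le1 t0.
have cN0 : 0 <= chi_factor t ^+ N by rewrite exprn_ge0// ltW.
have cN1 : chi_factor t ^+ N <= 1 by rewrite exprn_ile1// ltW.
set c := chi_factor t ^+ N in h cN0 cN1 *.
pose w := v / (1 + 2 * t).
have w0 : 0 <= w by rewrite divr_ge0//; lra.
have vw : v = w * (1 + 2 * t) by rewrite /w mulfVK// gt_eqF//; lra.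
have t20 := sqr_ge0 t.
have t2w0 : 0 <= 4 * t ^+ 2 * w by nra.
have wv : w <= v by rewrite vw; nra.
have Ev := expR_ge0 (- v); have Ew := expR_ge0 (- w).
have Evw : expR (- v) <= expR (- w) by rewrite ler_expR lerN2.
have Ev1 : expR (- v) <= 1 by rewrite expR_le1 oppr_le0.
pose y := 2 * t * w.
have y0 : 0 <= y by apply: mulr_ge0 => //; apply: mulr_ge0.
have Ey : expR (- w) = expR (- v) * expR y.
  by rewrite -expRD; congr expR; rewrite vw /y; ring.
have k1 : `|expR (- w) - expR (- v) * (1 + 2 * t * v)| <= 540 * t ^+ 2.
  have -> : expR (- w) - expR (- v) * (1 + 2 * t * v) =
    expR (- v) * (expR y - 1 - y) - expR (- v) * (4 * t ^+ 2 * w).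
    rewrite Ey [in 2 * t * v]vw /y; ring.
  have Evt := mulr_ge0 Ev t2w0.
  apply: (le_trans (ler_normB _ _)).
  rewrite [X in X + _]normrM (ger0_norm Ev) (ger0_norm Evt).
  have j1 : expR (- v) * `|expR y - 1 - y| <= 432 * t ^+ 2.
    apply: (le_trans (ler_wpM2l Ev (expR_taylor1 y))).
    have -> : expR (- v) * (2 * `|y| ^+ 2 * (1 + expR y)) =
        2 * (y ^+ 2 * (expR (- v) + expR (- w))).
      by rewrite (ger0_norm y0) Ey; ring.
    have y2 : 0 <= y ^+ 2 by rewrite sqr_ge0.
    have : y ^+ 2 * expR (- v) <= y ^+ 2 * expR (- w) by rewrite ler_wpM2l.
    have : y ^+ 2 * expR (- w) = 4 * t ^+ 2 * (w ^+ 2 * expR (- w)) by rewrite /y; ring.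
    have : 4 * t ^+ 2 * (w ^+ 2 * expR (- w)) <= 4 * t ^+ 2 * 27.
      rewrite ler_wpM2l//; first by lra.
      by apply: poly_expR_le => //; rewrite exprS; nra.
    by lra.
  have j2 : expR (- v) * (4 * t ^+ 2 * w) <= 108 * t ^+ 2.
    have : expR (- v) * (4 * t ^+ 2 * w) <= expR (- w) * (4 * t ^+ 2 * w).
      by rewrite ler_wpM2r.
    have : 4 * t ^+ 2 * (w * expR (- w)) <= 4 * t ^+ 2 * 27.
      rewrite ler_wpM2l//; first by lra.
      by apply: poly_expR_le => //; rewrite exprS; nra.
    by lra.
  by lra.
rewrite -/w distrC.
have -> : c * expR (- w) - expR (- v) * (1 - N%:R * t + 2 * t * v) =
   c * (expR (- w) - expR (- v) * (1 + 2 * t * v)) +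
   expR (- v) * (1 + 2 * t * v) * (c - (1 - N%:R * t))
   - 2 * N%:R * t ^+ 2 * (v * expR (- v)) by ring.
have p1 : expR (- v) * (1 + 2 * t * v) <= 27.
  by rewrite mulrC; apply: poly_expR_le => //; rewrite exprS; nra.
have p2 : v * expR (- v) <= 27.
  by apply: poly_expR_le => //; rewrite exprS; nra.
have p1' : 0 <= expR (- v) * (1 + 2 * t * v) by apply: mulr_ge0 => //; nra.
apply: (le_trans (ler_normB _ _)); apply: (@le_trans _ _
  (540 * t ^+ 2 + 27 * (C * t ^+ 2) + 2 * N%:R * t ^+ 2 * 27)); last by lra.
apply: lerD; last first.
  have Nt0 : 0 <= 2 * N%:R * t ^+ 2 by nra.
  have vE0 : 0 <= v * expR (- v) by exact: mulr_ge0.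
  by rewrite ger0_norm ?ler_wpM2l// mulr_ge0.
apply: (le_trans (ler_normD _ _)); rewrite !normrM; apply: lerD.
  by rewrite (ger0_norm cN0) -[leRHS]mul1r; apply: ler_pM.
by rewrite -normrM (ger0_norm p1'); apply: ler_pM.
Qed.

End chi_factor.

(** * Polynomial approximation *)

Section bernstein.
Context {R : realType}.
Implicit Types (g h : nat -> R) (u c : R) (n : nat).

(** The mean of [g] under the binomial law of parameters [n] and [u], as a polynomial in
    [u].  Conditioning on the first trial gives the recursion, which spares the binomial
    coefficients. *)
Fixpoint bernstein n g : {poly R} :=
  if n is n'.+1 then 'X * bernstein n' (g \o S) + (1 - 'X) * bernstein n' g
  else (g 0%N)%:P.

Lemma bernsteinS n g u : (bernstein n.+1 g).[u] =
  u * (bernstein n (g \o S)).[u] + (1 - u) * (bernstein n g).[u].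
Proof. by rewrite /= !hornerE. Qed.

Lemma bernstein_le n g h u : 0 <= u <= 1 ->
  (forall k, (k <= n)%N -> g k <= h k) -> (bernstein n g).[u] <= (bernstein n h).[u].
Proof.
move=> /andP[u0 u1]; elim: n g h => [|n IH] g h gh; first by rewrite !hornerE gh.
rewrite !bernsteinS lerD// ler_wpM2l ?subr_ge0//; apply: IH => k kn.
  by rewrite /= gh.
by rewrite gh// (leq_trans kn).
Qed.

Lemma bernstein_affine n g a b u :
  (bernstein n (fun k => a + b * g k)).[u] = a + b * (bernstein n g).[u].
Proof.
elim: n g => [|n IH] g; first by rewrite !hornerE.
rewrite !bernsteinS IH.
have -> : (fun k => a + b * g k) \o S = (fun k => a + b * (g \o S) k) by [].
by rewrite IH; ring.
Qed.

(** The variance of the binomial law, plus the squared distance of its mean to [c]. *)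
Lemma bernstein_sqr n u c : (bernstein n (fun k => (k%:R - c) ^+ 2)).[u] =
  n%:R * u * (1 - u) + (n%:R * u - c) ^+ 2.
Proof.
elim: n c => [|n IH] c; first by rewrite !hornerE.
rewrite bernsteinS IH.
rewrite (_ : _ \o S = (fun k : nat => (k%:R - (c - 1)) ^+ 2)); last first.
  by apply/funext => k /=; rewrite -natr1; congr (_ ^+ 2); ring.
by rewrite IH -natr1; ring.
Qed.

End bernstein.

Lemma continuous_segment_unif (R : realType) (f : R -> R) (a b e : R) :
  continuous f -> 0 < e -> exists2 r : R, 0 < r &
    forall x y : R, a <= x <= b -> `|x - y| < r -> `|f x - f y| < e.
Proof.
move=> cf e0.
have /compact_near_coveringP := @segment_compact R a b.
move=> /(_ R (0^'+) (fun r x => forall y : R, `|x - y| < r -> `|f x - f y| < e) _).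
case.
  move=> x _.
  have /cvgrPdist_lt/(_ (e / 2)) := cf x.
  rewrite divr_gt0// => /(_ isT) [r /= r0 hr].
  exists (ball x (r / 2), [set z | 0 < z < r / 2]).
    split; first by apply: nbhsx_ballx; rewrite divr_gt0.
    near=> z; apply/andP; split => //; near: z.
    by apply: nbhs_right_lt; rewrite divr_gt0.
  move=> [z s] [/= xz /andP[s0 sr]] y zy.
  have xz' : ball x r z by apply: le_ball xz; lra.
  have xy : ball x r y.
    rewrite /ball /= (le_lt_trans (ler_distD z _ _))//.
    by move: xz; rewrite /ball /=; lra.
  have := hr _ xz'; have := hr _ xy.
  by have := ler_distD (f x) (f z) (f y); rewrite (distrC (f z) (f x)); lra.
move=> r /= r0 hr; exists (r / 2); first by rewrite divr_gt0.
move=> x y xab xy; apply: (hr (r / 2)) => //=.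
- by rewrite sub0r normrN gtr0_norm; lra.
- by rewrite divr_gt0.
Unshelve. all: by end_near.
Qed.

(** The binomial mean of [f (k / n)] differs from [f u] by the modulus of continuity where
    [k / n] is within [r] of [u], and elsewhere by at most a multiple of
    [(k / n - u) ^+ 2], whose binomial mean is at most [1 / n]. *)
Lemma weierstrass_approximation (R : realType) (f : R -> R) (B e : R) :
  continuous f -> (forall x, 0 <= x <= 1 -> `|f x| <= B) -> 0 < e ->
  exists p : {poly R}, forall u, 0 <= u <= 1 -> `|f u - p.[u]| <= e.
Proof.
move=> cf fB e0.
have [r r0 fr] := continuous_segment_unif 0 1 cf (divr_gt0 e0 (ltr0n _ 2)).
have B0 : 0 <= B by apply: le_trans (fB 0 _); rewrite ?lexx ?ler01.
(* Large enough for the part of the error coming from far away to be at most [e / 2]. *)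
have [n nbig] : exists n, 2 * B / r ^+ 2 * 2 / e < n.+1%:R.
  exists (Num.truncn (2 * B / r ^+ 2 * 2 / e)).
  by rewrite truncnS_gt.
have n0 : 0 < n.+1%:R :> R by [].
exists (bernstein n.+1 (fun k => f (k%:R / n.+1%:R))) => u u01.
have /andP[u0 u1] := u01.
pose M := 2 * B / r ^+ 2.
have M0 : 0 <= M by rewrite divr_ge0 ?sqr_ge0 ?mulr_ge0.
pose D (k : nat) : R := (k%:R - n.+1%:R * u) ^+ 2.
pose M' := M / n.+1%:R ^+ 2.
have close (k : nat) : (k <= n.+1)%N -> `|f (k%:R / n.+1%:R) - f u| <= e / 2 + M' * D k.
  move=> kn; set x := k%:R / _.
  have x01 : 0 <= x <= 1 by rewrite divr_ge0//= ler_pdivrMr// mul1r ler_nat.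
  have -> : M' * D k = M * (x - u) ^+ 2.
    by rewrite /M' /D /x; field; rewrite lt0r_neq0.
  have [xu|xu] := ltP `|x - u| r.
    rewrite (le_trans (ltW (fr _ _ _ xu)))// lerDl mulr_ge0// sqr_ge0//.
  have : r ^+ 2 <= (x - u) ^+ 2.
    by rewrite -[leRHS]real_normK ?num_real// lerXn2r ?nnegrE// ltW.
  have r2 : 0 < r ^+ 2 by rewrite exprn_gt0.
  move=> /(ler_wpM2l M0); rewrite /M mulfVK ?gt_eqF// => h.
  have := fB _ x01; have := fB _ u01; have := ler_normB (f x) (f u).
  by move: h; rewrite /M; lra.
have tail : e / 2 + M' * (n.+1%:R * u * (1 - u)) <= e.
  have -> : M' * (n.+1%:R * u * (1 - u)) = M / n.+1%:R * (u * (1 - u)).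
    by rewrite /M'; field; rewrite lt0r_neq0.
  have : M / n.+1%:R <= e / 2.
    rewrite ler_pdivrMr//; move: (ltW nbig); rewrite -/M ler_pdivrMr//; lra.
  have : 0 <= M / n.+1%:R by rewrite divr_ge0.
  have : 0 <= u * (1 - u) <= 1 by apply/andP; split; nra.
  move: (M / _) (u * (1 - u)) => z p /andP[_ h1] h2 h3.
  by have := ler_piMr h2 h1; lra.
have main := bernstein_sqr n.+1 u (n.+1%:R * u).
rewrite subrr expr2 mulr0 addr0 -/D in main.
rewrite ler_norml; apply/andP; split.
  have : (bernstein n.+1 (fun k => f (k%:R / n.+1%:R))).[u] <=
     (f u + e / 2) + M' * (bernstein n.+1 D).[u].
    rewrite -bernstein_affine; apply: bernstein_le => // k kn.
    by have := close k kn; rewrite ler_norml => /andP[]; lra.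
  by rewrite main; lra.
have : (f u - e / 2) + (- M') * (bernstein n.+1 D).[u] <=
   (bernstein n.+1 (fun k => f (k%:R / n.+1%:R))).[u].
  rewrite -bernstein_affine; apply: bernstein_le => // k kn.
  by have := close k kn; rewrite ler_norml => /andP[]; lra.
by rewrite main; lra.
Qed.

(** * Means of bounded functions *)

Lemma cvg_invn (R : realType) : (fun n => n%:R^-1 : R) @ \oo --> 0.
Proof. by rewrite -cvg_shiftS; exact: cvg_harmonic. Qed.

Section bounded_expectation.
Context {d} {T : measurableType d} {R : realType} (P : probability T R).
Implicit Types f g : T -> R.

(** Everything that is averaged here is bounded, which makes integrability automatic. *)
Definition bounded_measurable f :=
  measurable_fun setT f /\ exists B : R, forall w, `|f w| <= B.

Lemma bounded_measurable_integrable f :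
  bounded_measurable f -> P.-integrable setT (EFin \o f).
Proof.
move=> [mf [B fB]]; apply: measurable_bounded_integrable => //.
  by rewrite (le_lt_trans (probability_le1 _ _))// ltry.
exists B; split; rewrite ?num_real// => M BM w _ /=.
by rewrite (le_trans (fB w))// ltW.
Qed.

Lemma bounded_measurable_cst r : bounded_measurable (fun=> r).
Proof. by split=> //; exists `|r|. Qed.

Lemma bounded_measurableD f g : bounded_measurable f -> bounded_measurable g ->
  bounded_measurable (fun w => f w + g w).
Proof.
move=> [mf [A fA]] [mg [B gB]]; split; first exact: measurable_funD.
by exists (A + B) => w; rewrite (le_trans (ler_normD _ _))// lerD.
Qed.

Lemma bounded_measurableM f g : bounded_measurable f -> bounded_measurable g ->
  bounded_measurable (fun w => f w * g w).
Proof.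
move=> [mf [A fA]] [mg [B gB]]; split; first exact: measurable_funM.
by exists (A * B) => w; rewrite normrM ler_pM.
Qed.

Lemma bounded_measurableN f : bounded_measurable f ->
  bounded_measurable (fun w => - f w).
Proof.
move=> [mf [A fA]]; split; last by exists A => w; rewrite normrN.
exact: measurableT_comp.
Qed.

Lemma bounded_measurableB f g : bounded_measurable f -> bounded_measurable g ->
  bounded_measurable (fun w => f w - g w).
Proof.
by move=> bf bg; apply: bounded_measurableD => //; exact: bounded_measurableN.
Qed.

Lemma bounded_measurable_sum (I : Type) (s : seq I) (F : I -> T -> R) :
  (forall i, bounded_measurable (F i)) ->
  bounded_measurable (fun w => \sum_(i <- s) F i w).
Proof.
move=> bF; elim: s => [|i s IH].
  under eq_fun do rewrite big_nil.
  exact: bounded_measurable_cst.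
under eq_fun do rewrite big_cons.
exact: bounded_measurableD.
Qed.

Lemma bounded_measurable_comp (g : R -> R) f B : measurable_fun setT g ->
  measurable_fun setT f -> (forall w, `|g (f w)| <= B) ->
  bounded_measurable (fun w => g (f w)).
Proof.
by move=> mg mf gB; split; [exact: measurableT_comp|exists B].
Qed.

Lemma bounded_measurable_norm f : bounded_measurable f ->
  bounded_measurable (fun w => `|f w|).
Proof.
move=> [mf [B fB]]; split; first exact: measurableT_comp.
by exists B => w; rewrite normr_id.
Qed.

Lemma bounded_measurable_indic (A : set T) : measurable A ->
  bounded_measurable (\1_A : T -> R).
Proof.
move=> mA; split; first exact: measurable_indic.
by exists 1 => w; rewrite indicE ger0_norm// lern1 leq_b1.
Qed.

Lemma mean_cst (r : R) : \int[P]_w r = r.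
Proof.
have PT : fine (P setT) = 1 by rewrite probability_setT.
by rewrite Rintegral_cst// [X in _ * X](_ : _ = 1) ?mulr1.
Qed.

Lemma meanD f g : bounded_measurable f -> bounded_measurable g ->
  \int[P]_w (f w + g w) = \int[P]_w f w + \int[P]_w g w.
Proof. by move=> bf bg; rewrite RintegralD//; exact: bounded_measurable_integrable. Qed.

Lemma meanB f g : bounded_measurable f -> bounded_measurable g ->
  \int[P]_w (f w - g w) = \int[P]_w f w - \int[P]_w g w.
Proof. by move=> bf bg; rewrite RintegralB//; exact: bounded_measurable_integrable. Qed.

Lemma meanZ f r : bounded_measurable f ->
  \int[P]_w (r * f w) = r * \int[P]_w f w.
Proof. by move=> bf; rewrite RintegralZl//; exact: bounded_measurable_integrable. Qed.

Lemma mean_sum (I : Type) (s : seq I) (F : I -> T -> R) :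
  (forall i, bounded_measurable (F i)) ->
  \int[P]_w (\sum_(i <- s) F i w) = \sum_(i <- s) \int[P]_w F i w.
Proof.
move=> bF; elim: s => [|i s IH].
  by rewrite big_nil; under eq_Rintegral do rewrite big_nil; exact: mean_cst.
rewrite big_cons -IH; under eq_Rintegral do rewrite big_cons.
by rewrite meanD//; exact: bounded_measurable_sum.
Qed.

Lemma le_mean f g : bounded_measurable f -> bounded_measurable g ->
  (forall w, f w <= g w) -> \int[P]_w f w <= \int[P]_w g w.
Proof.
by move=> bf bg fg; apply: le_Rintegral => //; exact: bounded_measurable_integrable.
Qed.

Lemma mean_norm_le f B : bounded_measurable f -> (forall w, `|f w| <= B) ->
  `|\int[P]_w f w| <= B.
Proof.
move=> bf fB; rewrite (le_trans (le_normr_Rintegral _ _))//.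
  exact: bounded_measurable_integrable.
rewrite -[leRHS](mean_cst B) le_mean//; first exact: bounded_measurable_norm.
exact: bounded_measurable_cst.
Qed.

Lemma mean_indic (A : set T) : measurable A -> \int[P]_w \1_A w = fine (P A).
Proof. by move=> mA; rewrite /Rintegral integral_indic// setIT. Qed.

(** Markov's inequality for the square. *)
Lemma prob_ge_le_mean_sqr f (e : R) : bounded_measurable f -> 0 < e ->
  fine (P [set w | e <= `|f w|]) <= e ^- 2 * \int[P]_w (f w ^+ 2).
Proof.
move=> bf e0; have [mf _] := bf.
have mA : measurable [set w | e <= `|f w|].
  rewrite -[X in measurable X]setTI.
  by apply: measurable_fun_le => //; exact: measurableT_comp.
have bf2 : bounded_measurable (fun w => f w ^+ 2) by apply: bounded_measurableM.
rewrite -mean_indic// -meanZ//; apply: le_mean.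
- exact: bounded_measurable_indic.
- by apply: bounded_measurableM => //; exact: bounded_measurable_cst.
move=> w; rewrite indicE; case: (boolP (w \in _)) => [|_].
  rewrite inE /= => ew; rewrite mulrC ler_pdivlMr ?exprn_gt0// mul1r.
  by rewrite -[leRHS]real_normK ?num_real// lerXn2r ?nnegrE// ltW.
by apply: mulr_ge0; rewrite ?sqr_ge0// invr_ge0 exprn_ge0// ltW.
Qed.

End bounded_expectation.

(** * Independent samples *)

Section independence.
Context d (Omega : measurableType d) (R : realType) (P : probability Omega R).

(** The joint law of two independent real variables is the product of their
    laws, so the product rule for means is Fubini's theorem. *)
Lemma mean_mul_indep (U V : Omega -> R) :
  bounded_measurable U -> bounded_measurable V ->
  (forall A B : set R, measurable A -> measurable B ->
    P (U @^-1` A `&` V @^-1` B) = (P (U @^-1` A) * P (V @^-1` B))%E) ->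
  \int[P]_w (U w * V w) = \int[P]_w U w * \int[P]_w V w.
Proof.
move=> bU bV UV; have [mU _] := bU; have [mV _] := bV.
pose fU : {mfun Omega >-> R} := HB.pack U (isMeasurableFun.Build _ _ _ _ _ mU).
pose fV : {mfun Omega >-> R} := HB.pack V (isMeasurableFun.Build _ _ _ _ _ mV).
have mW : measurable_fun setT (fun w => (U w, V w)) by exact: measurable_fun_pair.
pose W : {mfun Omega >-> (R * R)%type} :=
  HB.pack (fun w => (U w, V w)) (isMeasurableFun.Build _ _ _ _ _ mW).
pose h (z : R * R) : \bar R := (z.1 * z.2)%:E.
have mh : measurable_fun setT h.
  by apply/measurable_EFinP; apply: measurable_funM.
have joint (A : set (R * R)) : measurable A ->
    (distribution P fU \x distribution P fV)%E A = distribution P W A.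
  by apply: product_measure_unique => A' B' mA mB; rewrite -UV.
have iUV : P.-integrable setT (h \o W).
  exact: bounded_measurable_integrable (bounded_measurableM bU bV).
have ih : (distribution P fU \x distribution P fV)%E.-integrable setT h.
  apply/integrableP; split=> //.
  rewrite (eq_measure_integral (distribution P W)); last first.
    by move=> A mA _; exact: joint.
  rewrite ge0_integral_pushforward//; last exact: measurableT_comp.
  by have /integrableP[_] := iUV.
have -> : \int[P]_w (U w * V w) = fine (\int[distribution P W]_z h z)%E.
  by rewrite integral_distribution.
rewrite (eq_measure_integral (distribution P fU \x distribution P fV)%E); last first.
  by move=> A mA _; exact/esym/joint.
rewrite -integral12_prod_meas1//.
have iV : (distribution P fV).-integrable setT (EFin : R -> \bar R).
  apply/integrableP; split=> //.
  rewrite ge0_integral_pushforward//; last by apply: measurableT_comp.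
  by have /integrableP[_] := bounded_measurable_integrable P bV.
have VE : (\int[distribution P fV]_y y%:E)%E = (\int[P]_w V w)%:E.
  rewrite integral_distribution//; last exact: bounded_measurable_integrable.
  by rewrite fineK//; apply: integrable_fin_num => //; exact: bounded_measurable_integrable.
transitivity (fine (\int[distribution P fU]_x (x * \int[P]_w V w)%:E)%E).
  congr fine; apply: eq_integral => x _.
  by rewrite /fubini_F/h/=; under eq_integral do rewrite EFinM; rewrite integralZl// VE.
rewrite integral_distribution//=.
- exact: (RintegralZr _ measurableT (bounded_measurable_integrable P bU)).
- by apply/measurable_EFinP; exact: measurable_funM.
- apply: bounded_measurable_integrable; apply: bounded_measurableM => //.
  exact: bounded_measurable_cst.
Qed.

(** Since the events fixing finitely many coordinates are stable under
    intersection, the product rule extends to all events of the past. *)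
Section past.
Context d' (S : measurableType d') (Y : nat -> {RV P >-> S}).
Hypothesis Y_indep : mutually_independent Y.
Variable k : nat.

Definition past_cylinders : set (set Omega) :=
  [set C | exists2 A : nat -> set S, (forall r, measurable (A r)) &
     C = \big[setI/setT]_(r <- iota 0 k) (Y r @^-1` A r)].

Definition past : set (set Omega) := <<s past_cylinders >>.

Lemma past_measurable : past `<=` measurable.
Proof.
apply: smallest_sub; first exact: sigma_algebra_measurable.
move=> _ [A mA ->]; apply: big_ind => //; first exact: measurableI.
by move=> r _; exact: measurable_funPTI.
Qed.

Lemma indep_past (C : set Omega) (A : set S) : past C -> measurable A ->
  P (C `&` Y k @^-1` A) = (P C * P (Y k @^-1` A))%E.
Proof.
move=> pC mA.
have mYA : measurable (Y k @^-1` A) by exact: measurable_funPTI.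
pose m1 : {measure set Omega -> \bar R} := mrestr P mYA.
have fA : P (Y k @^-1` A) \is a fin_num by exact: fin_num_measure.
have c0 : 0 <= fine (P (Y k @^-1` A)) by exact: fine_ge0.
pose m2 : {measure set Omega -> \bar R} := mscale (NngNum c0) P.
have m1E B : m1 B = P (B `&` Y k @^-1` A) by [].
have m2E B : m2 B = (P B * P (Y k @^-1` A))%E by rewrite muleC -[in RHS](fineK fA).
suff : m1 C = m2 C by rewrite m1E m2E.
have cyl_measurable : past_cylinders `<=` measurable.
  by move=> B cB; apply: past_measurable; exact: sub_sigma_algebra.
have cylT (i : nat) : past_cylinders setT by exists (fun=> setT) => //; rewrite big1.
have cylI : setI_closed past_cylinders.
  move=> _ _ [B1 mB1 ->] [B2 mB2 ->]; exists (fun r => B1 r `&` B2 r).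
    by move=> r; exact: measurableI.
  by rewrite -big_split; apply: eq_bigr => r _; rewrite preimage_setI.
apply: (g_sigma_algebra_measure_unique _ cyl_measurable _ cylT _ m1 m2 cylI _ _ _ pC).
- exact: bigcup_const.
- move=> _ [B mB ->].
  pose B' r := if r == k then A else B r.
  have mB' r : measurable (B' r) by rewrite /B'; case: ifP.
  have kB' : B' k = A by rewrite /B' eqxx.
  have rB' r : r \in iota 0 k -> B' r = B r.
    by rewrite mem_iota /B' add0n => /andP[_ rk]; rewrite lt_eqF.
  have -> : \big[setI/setT]_(r <- iota 0 k) (Y r @^-1` B r) =
      \big[setI/setT]_(r <- iota 0 k) (Y r @^-1` B' r).
    by apply: eq_big_seq => r /rB' ->.
  rewrite m1E m2E (Y_indep (iota_uniq 0 k) mB').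
  have kuniq : uniq (rcons (iota 0 k) k).
    by rewrite rcons_uniq iota_uniq mem_iota add0n ltnn andbF.
  have := Y_indep kuniq mB'.
  by rewrite !big_rcons /= kB' => ->.
- move=> n; rewrite m1E.
  by rewrite (le_lt_trans (probability_le1 _ _))// ?ltry//; exact: measurableI.
Qed.

(** The events of [past] make [Omega] a coarser measurable space, on which the
    measurable functions are the functions of the past. *)
Notation past_type := (g_sigma_algebraType past_cylinders).

Lemma bounded_measurable_pastW (U : Omega -> R) :
  @bounded_measurable _ past_type R U -> bounded_measurable U.
Proof.
by move=> [mU bU]; split=> // _ B mB; apply: past_measurable; exact: mU.
Qed.

Lemma bounded_measurable_past (f : S -> R) r : bounded_measurable f -> (r < k)%N ->
  @bounded_measurable _ past_type R (fun w => f (Y r w)).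
Proof.
move=> [mf [b fb]] rk; split; last by exists b.
move=> _ B mB; rewrite setTI; apply: sub_sigma_algebra.
exists (fun i => if i == r then f @^-1` B else setT).
  by move=> i; case: ifP => // _; rewrite -[X in measurable X]setTI; exact: mf.
rewrite (bigD1_seq r) ?iota_uniq ?mem_iota//= eqxx big1 ?setIT// => i /negbTE ->.
by rewrite preimage_setT.
Qed.

Lemma bounded_measurable_now (f : S -> R) r : bounded_measurable f ->
  bounded_measurable (fun w => f (Y r w)).
Proof. by move=> [mf [b fb]]; split; [exact: measurableT_comp|exists b]. Qed.

(** What is observed at time [k] is independent of every function of the past. *)
Lemma mean_mul_past (U : Omega -> R) (f : S -> R) :
  @bounded_measurable _ past_type R U -> bounded_measurable f ->
  \int[P]_w (U w * f (Y k w)) = \int[P]_w U w * \int[P]_w f (Y k w).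
Proof.
move=> bU bf; apply: mean_mul_indep.
- exact: bounded_measurable_pastW.
- exact: bounded_measurable_now.
move=> A A' mA mA'; apply: (@indep_past _ (f @^-1` A')).
- by rewrite -[X in past X]setTI; exact: bU.1.
- by rewrite -[X in measurable X]setTI; exact: bf.1.
Qed.

End past.

Section sample.
Context d' (S : measurableType d') (Q : probability S R) (Y : nat -> {RV P >-> S}).
Hypothesis Y_indep : mutually_independent Y.
Hypothesis Y_law : forall r (A : set S), measurable A -> distribution P (Y r) A = Q A.

Lemma mean_law (f : S -> R) r : bounded_measurable f ->
  \int[P]_w f (Y r w) = \int[Q]_y f y.
Proof.
move=> bf; rewrite /Rintegral; congr fine.
rewrite -(eq_measure_integral Q (m1 := distribution P (Y r))); last first.
  by move=> A mA _; exact: Y_law.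
rewrite integral_distribution//; first by apply/measurable_EFinP; exact: bf.1.
exact: bounded_measurable_integrable (bounded_measurable_now Y r bf).
Qed.

Lemma mean_sqr_sum (f : S -> R) n : bounded_measurable f -> \int[Q]_y f y = 0 ->
  \int[P]_w ((\sum_(r < n) f (Y r w)) ^+ 2) = n%:R * \int[Q]_y (f y ^+ 2).
Proof.
move=> bf f0; have bf2 : bounded_measurable (fun y => f y ^+ 2) by apply: bounded_measurableM.
elim: n => [|n IH].
  under eq_Rintegral do rewrite big_ord0 expr0n/=.
  by rewrite mean_cst mul0r.
have bU : @bounded_measurable _ (g_sigma_algebraType (past_cylinders Y n)) R
    (fun w => \sum_(r < n) f (Y r w)).
  by apply: bounded_measurable_sum => r; exact: bounded_measurable_past.
have bU' := bounded_measurable_pastW bU.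
have bfn := bounded_measurable_now Y n bf.
have E w : (\sum_(r < n.+1) f (Y r w)) ^+ 2 = (\sum_(r < n) f (Y r w)) ^+ 2 +
    (2 * ((\sum_(r < n) f (Y r w)) * f (Y n w)) + f (Y n w) ^+ 2).
  by rewrite big_ord_recr /=; ring.
under eq_Rintegral do rewrite E.
have bM := bounded_measurableM.
have b1 : bounded_measurable (fun w => (\sum_(r < n) f (Y r w)) ^+ 2) by apply: bM.
have b2 : bounded_measurable (fun w => (\sum_(r < n) f (Y r w)) * f (Y n w)) by apply: bM.
have b3 : bounded_measurable (fun w => f (Y n w) ^+ 2) by apply: bM.
have b4 := bM _ _ _ _ _ (bounded_measurable_cst (2 : R)) b2.
rewrite meanD//; last exact: bounded_measurableD.
rewrite meanD// meanZ// (mean_mul_past Y_indep bU bf) (mean_law n bf) f0 !mulr0 add0r.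
by rewrite (mean_law n bf2) IH -natr1; ring.
Qed.

(** Chebyshev's form of the law of large numbers. *)
Lemma weak_law (f : S -> R) (e : R) : bounded_measurable f -> 0 < e ->
  (fun n => fine (P [set w | e <= `|n%:R^-1 * (\sum_(r < n) f (Y r w)) -
     \int[Q]_y f y|])) @ \oo --> 0.
Proof.
move=> bf e0.
pose c := \int[Q]_y f y.
have bg : bounded_measurable (fun y => f y - c).
  by apply: bounded_measurableB => //; exact: bounded_measurable_cst.
have g0 : \int[Q]_y (f y - c) = 0.
  by rewrite meanB ?mean_cst ?subrr//; exact: bounded_measurable_cst.
pose M := e ^- 2 * \int[Q]_y ((f y - c) ^+ 2).
apply: (@squeeze_cvgr _ _ _ _ (fun=> 0) (fun n => M * n%:R^-1)); last 2 first.
- exact: cvg_cst.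
- by rewrite -[X in _ --> X](mulr0 M); apply: cvgMl_tmp; exact: cvg_invn.
near=> n; apply/andP; split; first by rewrite fine_ge0.
have n0 : 0 < n%:R :> R by rewrite ltr0n; near: n; exact: nbhs_infty_gt.
have nN0 : n%:R != 0 :> R by rewrite gt_eqF.
have bs : bounded_measurable (fun w => \sum_(r < n) (f (Y r w) - c)).
  by apply: bounded_measurable_sum => r; exact: (bounded_measurable_now Y r bg).
have E w : n%:R^-1 * (\sum_(r < n) f (Y r w)) - c = n%:R^-1 * \sum_(r < n) (f (Y r w) - c).
  by rewrite sumrB sumr_const card_ord -[c *+ n]mulr_natl; field.
have -> : [set w | e <= `|n%:R^-1 * (\sum_(r < n) f (Y r w)) - c|] =
    [set w | n%:R * e <= `|\sum_(r < n) (f (Y r w) - c)|].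
  apply/seteqP; split => w /=; rewrite E normrM ger0_norm ?invr_ge0//.
    by rewrite [leRHS]mulrC ler_pdivlMr// mulrC.
  by rewrite [X in _ -> _ <= X]mulrC ler_pdivlMr// mulrC.
rewrite (le_trans (prob_ge_le_mean_sqr _ bs _))//; first by rewrite mulr_gt0.
rewrite (mean_sqr_sum n bg g0) /M le_eqVlt; apply/orP; left; apply/eqP.
by field; rewrite nN0 gt_eqF.
Unshelve. all: by end_near.
Qed.

End sample.

End independence.

(** * Laplace transforms and convergence in law *)

(** The means of the powers of [exp (- X)] determine those of every bounded continuous
    function of [X]: after the substitution [u = exp (- x)] this is polynomial
    approximation on the unit interval, once [f] has been multiplied by
    [1 - (1 - exp (- x)) ^+ N], which makes it vanish at infinity. *)
Section laplace_determines_law.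
Context d (Omega : measurableType d) (R : realType) (P : probability Omega R).
Variables (X : nat -> Omega -> R) (mu : probability R R).
Hypothesis mX : forall n, measurable_fun setT (X n).
Hypothesis X_ge0 : forall n w, 0 <= X n w.
Hypothesis X_laplace : forall k : nat,
  (fun n => \int[P]_w expR (- (k%:R * X n w))) @ \oo -->
  \int[mu]_x expR (- (k%:R * `|x|)).

Lemma expRN_itv (x : R) : 0 <= x -> 0 <= expR (- x) <= 1.
Proof. by move=> x0; rewrite expR_ge0 expR_le1 oppr_le0. Qed.

Lemma bounded_measurable_expX d0 (T : measurableType d0) (k : nat) (Z : T -> R) :
  measurable_fun setT Z -> (forall w, 0 <= Z w) ->
  bounded_measurable (fun w => expR (- (k%:R * Z w))).
Proof.
move=> mZ Z0; apply: (@bounded_measurable_comp _ _ _ (fun x => expR (- (k%:R * x))) _ 1) => //.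
  by apply: measurableT_comp => //; apply: measurableT_comp => //.
move=> w; rewrite ger0_norm ?expR_ge0// expR_le1 oppr_le0 mulr_ge0//.
Qed.

Lemma hornerE_exp (p : {poly R}) x :
  p.[expR (- x)] = \sum_(i < size p) p`_i * expR (- (i%:R * x)).
Proof.
rewrite horner_coef; apply: eq_bigr => i _.
by rewrite -expRM_natl mulrN.
Qed.

Lemma bounded_measurable_poly d0 (T : measurableType d0) (p : {poly R}) (Z : T -> R) :
  measurable_fun setT Z -> (forall w, 0 <= Z w) ->
  bounded_measurable (fun w => p.[expR (- Z w)]).
Proof.
move=> mZ Z0; under eq_fun do rewrite hornerE_exp.
apply: bounded_measurable_sum => i; apply: bounded_measurableM.
  exact: bounded_measurable_cst.
exact: bounded_measurable_expX.
Qed.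

Lemma mean_poly d0 (T : measurableType d0) (m : probability T R) (p : {poly R}) (Z : T -> R) :
  measurable_fun setT Z -> (forall w, 0 <= Z w) ->
  \int[m]_w p.[expR (- Z w)] = \sum_(i < size p) p`_i * \int[m]_w expR (- (i%:R * Z w)).
Proof.
move=> mZ Z0; under eq_Rintegral do rewrite hornerE_exp.
have bX i := bounded_measurable_expX i mZ Z0.
rewrite mean_sum; last first.
  by move=> i; apply: bounded_measurableM => //; exact: bounded_measurable_cst.
by apply: eq_bigr => i _; rewrite meanZ.
Qed.

Let mabs : measurable_fun setT (fun x : R => `|x|).
Proof. exact: measurableT_comp. Qed.

Lemma cvg_mean_poly (p : {poly R}) :
  (fun n => \int[P]_w p.[expR (- X n w)]) @ \oo --> \int[mu]_x p.[expR (- `|x|)].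
Proof.
rewrite mean_poly//; under eq_fun do rewrite mean_poly//.
apply: cvg_big => [|i _]; [exact: add_continuous|apply: cvgMl_tmp; exact: X_laplace].
Qed.

(** No mass of [mu] sits at infinity, where [1 - exp (- x)] is 1. *)
Lemma mean_escape_cvg0 : (fun N => \int[mu]_x (1 - expR (- `|x|)) ^+ N) @ \oo --> 0.
Proof.
have e01 (x : R) : 0 <= 1 - expR (- `|x|) <= 1.
  by have := expRN_itv (normr_ge0 x); lra.
have mf N : measurable_fun setT (fun x : R => (1 - expR (- `|x|)) ^+ N).
  apply: measurable_funX; apply: measurable_funB => //.
  by apply: measurableT_comp => //; apply: measurableT_comp.
have : (\int[mu]_x ((1 - expR (- `|x|)) ^+ N)%:E)%E @[N --> \oo] -->
    (\int[mu]_x (cst 0%:E) x)%E.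
  apply: (@dominated_cvg _ _ _ mu setT measurableT _ _ (cst 1%E)) => //.
  - by move=> N; apply/measurable_EFinP.
  - move=> x _; apply/fine_cvgP; split; first exact: nearW.
    apply: cvg_expr; have /andP[h1 _] := e01 x; by rewrite ger0_norm.
  - apply: (bounded_measurable_integrable mu); exact: (bounded_measurable_cst (1 : R)).
  - move=> N x _ /=; rewrite lee_fin; have /andP[h1 h2] := e01 x.
    by rewrite ger0_norm ?exprn_ge0// exprn_ile1.
rewrite integral0 => h.
by have /fine_cvgP[_] := h.
Qed.

(* [f] after the substitution [u = exp (- x)], damped to vanish at [u = 0]. *)
Let damped (f : R -> R) N (u : R) := f (- ln u) * (1 - (1 - u) ^+ N).

(** At [u = 0], where [ln] is discontinuous, the damping factor vanishes and [f] is
    bounded. *)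
Lemma damped_continuous (f : R -> R) (B : R) N : continuous f ->
  (forall x, `|f x| <= B) -> continuous (damped f N).
Proof.
move=> cf fB u.
have cp : continuous (fun v : R => 1 - (1 - v) ^+ N).
  pose p : {poly R} := 1 - (1 - 'X) ^+ N.
  have -> : (fun v : R => 1 - (1 - v) ^+ N) = horner p.
    by apply/funext => v; rewrite /p !hornerE.
  exact: continuous_horner.
have B0 : 0 <= B by apply: le_trans (fB 0).
change (damped f N @ u --> damped f N u).
have [u0|u0|u0] := ltgtP u 0.
- have -> : damped f N u = f (- ln 0) * (1 - (1 - u) ^+ N).
    by rewrite /damped !ln0// ltW.
  apply: (@cvg_trans _ ((fun v => f (- ln 0) * (1 - (1 - v) ^+ N)) @ u)).
    apply: near_eq_cvg; near=> v; rewrite /damped !ln0//.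
    by apply: ltW; near: v; exact: lt_nbhsl.
  exact: (cvgM (cvg_cst _) (cp u)).
- apply: (cvgM _ (cp u)).
  apply: continuous_comp; last exact: cf.
  by apply: continuous_comp; [exact: continuous_ln|exact: opp_continuous].
rewrite u0 /damped subr0 expr1n subrr mulr0.
have c0 : (fun v : R => B * (1 - (1 - v) ^+ N)) @ (0 : R) --> (0 : R).
  rewrite -[X in _ --> X](mulr0 B); apply: cvgMl_tmp.
  by have := cp 0; rewrite /continuous_at subr0 expr1n subrr.
apply/cvgrPdist_le => e e0; move/cvgrPdist_le : c0 => /(_ e e0).
apply: filterS => v; rewrite !sub0r !normrN; apply: le_trans.
by rewrite normrM [leRHS]normrM ler_wpM2r// (ger0_norm B0).
Unshelve. all: by end_near.
Qed.

Theorem laplace_determines_law (f : R -> R) (B : R) : continuous f ->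
  (forall x, `|f x| <= B) ->
  (fun n => \int[P]_w f (X n w)) @ \oo --> \int[mu]_x f `|x|.
Proof.
move=> cf fB.
have B0 : 0 <= B by apply: le_trans (fB 0).
have mf : measurable_fun setT f by exact: continuous_measurable_fun.
apply/cvgrPdist_le => e e0.
pose a := e / (4 * (B + 1)).
have a0 : 0 < a by rewrite divr_gt0// mulr_gt0//; lra.
have ae : 4 * ((B + 1) * a) <= e by rewrite mulrA /a mulrC divfK// gt_eqF// mulr_gt0//; lra.
have [N _ hN] : \forall N \near \oo, `|0 - \int[mu]_x (1 - expR (- `|x|)) ^+ N| <= a.
  by have /cvgrPdist_le/(_ a a0) := mean_escape_cvg0.
have {hN} muN : \int[mu]_x (1 - expR (- `|x|)) ^+ N <= a.
  have := hN N (leqnn N); rewrite sub0r normrN; apply: le_trans; exact: ler_norm.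
have [p hp] : exists p : {poly R}, forall u, 0 <= u <= 1 -> `|damped f N u - p.[u]| <= a.
  apply: (@weierstrass_approximation _ _ B) => //.
    exact: damped_continuous cf fB.
  move=> u /andP[u0 u1]; rewrite /damped normrM -[leRHS]mulr1 ler_pM//.
  have : 0 <= (1 - u) ^+ N <= 1 by rewrite exprn_ge0 ?exprn_ile1//; lra.
  by move=> ?; rewrite ger0_norm; lra.
pose esc : {poly R} := (1 - 'X) ^+ N.
have escE u : esc.[u] = (1 - u) ^+ N by rewrite /esc !hornerE.
have close x : 0 <= x -> `|f x - p.[expR (- x)]| <= a + B * esc.[expR (- x)].
  move=> x0; have := hp _ (expRN_itv x0).
  rewrite /damped expRK opprK -escE => h.
  have esc0 : 0 <= esc.[expR (- x)].
    by rewrite escE exprn_ge0//; have := expRN_itv x0; lra.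
  have -> : f x - p.[expR (- x)] =
     (f x * (1 - esc.[expR (- x)]) - p.[expR (- x)]) + f x * esc.[expR (- x)] by ring.
  by rewrite (le_trans (ler_normD _ _))// lerD// normrM (ger0_norm esc0) ler_wpM2r.
have total d0 (T : measurableType d0) (m : probability T R) (Z : T -> R) :
    measurable_fun setT Z -> (forall w, 0 <= Z w) ->
    `|\int[m]_w f (Z w) - \int[m]_w p.[expR (- Z w)]| <=
      a + B * \int[m]_w esc.[expR (- Z w)].
  move=> mZ Z0.
  have bf : bounded_measurable (fun w => f (Z w)).
    by apply: (bounded_measurable_comp mf mZ) => w; exact: fB.
  have bp := bounded_measurable_poly p mZ Z0.
  have be := bounded_measurable_poly esc mZ Z0.
  have bc (r : R) : bounded_measurable (fun _ : T => r) := bounded_measurable_cst r.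
  have bBe := bounded_measurableM (bc B) be.
  rewrite -meanB// (le_trans (le_normr_Rintegral _ _))//.
    by apply: bounded_measurable_integrable; exact: bounded_measurableB.
  rewrite -meanZ// -[X in X + _](mean_cst m) -(meanD m (bc a) bBe).
  apply: le_mean; first by apply: bounded_measurable_norm; exact: bounded_measurableB.
    exact: bounded_measurableD.
  by move=> w; exact: close.
have /cvgrPdist_le/(_ a a0) cvp := @cvg_mean_poly p.
have /cvgrPdist_le/(_ a a0) cve := @cvg_mean_poly esc.
near=> n.
have h1 := total _ _ P (X n) (mX n) (X_ge0 n).
have h2 := total _ _ mu (fun x => `|x|) mabs (fun x => normr_ge0 x).
have h3 : `|\int[mu]_x p.[expR (- `|x|)] - \int[P]_w p.[expR (- X n w)]| <= a by near: n.
have h4 : `|\int[mu]_x esc.[expR (- `|x|)] - \int[P]_w esc.[expR (- X n w)]| <= a by near: n.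
have muN' : \int[mu]_x esc.[expR (- `|x|)] <= a.
  by under eq_Rintegral do rewrite escE.
move: h1 h2 h3 h4 muN'.
set f1 := \int[P]_w _; set p1 := \int[P]_w _; set e1 := \int[P]_w _.
set f2 := \int[mu]_w _; set p2 := \int[mu]_w _; set e2 := \int[mu]_w _.
move=> h1 h2 h3 h4 muN'.
have h5 : e1 <= 2 * a by have := ler_norm (e1 - e2); rewrite distrC; lra.
have h6 := ler_wpM2l B0 h5; have h7 := ler_wpM2l B0 muN'.
have h8 := ler_distD p2 f2 f1; have h9 := ler_distD p1 p2 f1.
by rewrite (distrC p1) in h9; lra.
Unshelve. all: by end_near.
Qed.

End laplace_determines_law.

(** * Quadratic forms *)

Section quadratic_form.
Context {R : realType} {N : nat}.
Implicit Types (A V : 'M[R]_N) (x y h : 'rV[R]_N).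

Definition bform V x y : R := (x *m V *m y^T) ord0 ord0.
Notation qform V x := (bform V x x).

Lemma bformE V x y : bform V x y = \sum_i (x *m V) ord0 i * y ord0 i.
Proof. by rewrite /bform mxE; apply: eq_bigr => i _; rewrite [_^T _ _]mxE. Qed.

Lemma bformE2 V x y : bform V x y = \sum_i \sum_j V j i * (x ord0 j * y ord0 i).
Proof.
rewrite bformE; apply: eq_bigr => i _; rewrite mxE big_distrl /=.
by apply: eq_bigr => j _; ring.
Qed.

Lemma bformDl V x y h : bform V (x + y) h = bform V x h + bform V y h.
Proof. by rewrite /bform !mulmxDl mxE. Qed.

Lemma bformDr V x y h : bform V h (x + y) = bform V h x + bform V h y.
Proof. by rewrite /bform raddfD/= mulmxDr mxE. Qed.

Lemma bformZl V a x h : bform V (a *: x) h = a * bform V x h.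
Proof. by rewrite /bform -!scalemxAl mxE. Qed.

Lemma bformZr V a x h : bform V h (a *: x) = a * bform V h x.
Proof. by rewrite /bform linearZ/= -scalemxAr mxE. Qed.

Lemma bformBm A V x y : bform (A - V) x y = bform A x y - bform V x y.
Proof. by rewrite /bform mulmxBr mulmxBl !mxE. Qed.

Lemma bformC V x y : V^T = V -> bform V x y = bform V y x.
Proof.
move=> VT; transitivity ((x *m V *m y^T)^T ord0 ord0); first by rewrite [RHS]mxE.
by rewrite !trmx_mul trmxK VT mulmxA.
Qed.

Lemma qformD V x h : V^T = V -> qform V (x + h) = qform V x + 2 * bform V x h + qform V h.
Proof.
by move=> VT; rewrite bformDl !bformDr (bformC h x VT); ring.
Qed.

(** The form may be degenerate: when both [x] and [h] are isotropic, the form of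
    [x - bform V x h *: h] is [- 2 * bform V x h ^+ 2]. *)
Lemma bform_cauchy_schwarz V x h : V^T = V -> (forall z, 0 <= qform V z) ->
  bform V x h ^+ 2 <= qform V x * qform V h.
Proof.
move=> VT V0.
have key (y z : 'rV[R]_N) : 0 < qform V z -> bform V y z ^+ 2 <= qform V y * qform V z.
  move=> z0; have := V0 (qform V z *: y + (- bform V y z) *: z).
  rewrite qformD// !bformZl !bformZr => h0.
  have : 0 <= qform V z * (qform V y * qform V z - bform V y z ^+ 2).
    by move: h0; congr (0 <= _); ring.
  by rewrite pmulr_rge0// subr_ge0.
have := V0 h; rewrite le_eqVlt => /predU1P[h0|/key//].
have := V0 x; rewrite le_eqVlt => /predU1P[x0|/key H]; last first.
  by rewrite (bformC x h VT) mulrC.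
have := V0 (x + (- bform V x h) *: h).
rewrite qformD// !bformZl !bformZr -h0 -x0.
by have := sqr_ge0 (bform V x h); rewrite expr2; lra.
Qed.

Lemma qform_inv A x : A \in unitmx -> A^T = A ->
  qform (invmx A) x = qform A (x *m invmx A).
Proof.
move=> uA AT; rewrite /bform trmx_mul trmx_inv AT.
by rewrite -!mulmxA (mulmxA A) mulmxV// mul1mx.
Qed.

End quadratic_form.
Notation qform V x := (bform V x x).

(** * A central limit theorem for quadratic forms *)

Section laplace_clt.
Context d (Omega : measurableType d) (R : realType) (P : probability Omega R).
Context d' (S : measurableType d') (Q : probability S R) (Y : nat -> {RV P >-> S}).
Hypothesis Y_indep : mutually_independent Y.
Hypothesis Y_law : forall r (A : set S), measurable A -> distribution P (Y r) A = Q A.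
Variables (N : nat) (z : S -> 'rV[R]_N) (Sg : 'M[R]_N).
Hypothesis z_bounded : forall i, bounded_measurable (fun y => z y ord0 i).
Hypothesis z_mean0 : forall i, \int[Q]_y z y ord0 i = 0.
Hypothesis z_cov : forall i j, \int[Q]_y (z y ord0 i * z y ord0 j) = Sg i j.
Hypothesis Sg_unit : Sg \in unitmx.

Let V := invmx Sg.

Lemma cov_sym : Sg^T = Sg.
Proof.
apply/matrixP => i j; rewrite mxE -!z_cov.
by apply: eq_Rintegral => y _; rewrite mulrC.
Qed.

Lemma bounded_measurable_bform d0 (T : measurableType d0) (A : 'M[R]_N)
    (x y : T -> 'rV[R]_N) :
  (forall i, bounded_measurable (fun w => x w ord0 i)) ->
  (forall i, bounded_measurable (fun w => y w ord0 i)) ->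
  bounded_measurable (fun w => bform A (x w) (y w)).
Proof.
move=> bx by_; under eq_fun do rewrite bformE2.
apply: bounded_measurable_sum => i; apply: bounded_measurable_sum => j.
apply: bounded_measurableM; first exact: bounded_measurable_cst.
exact: bounded_measurableM.
Qed.

Lemma cov_ge0 x : 0 <= qform Sg x.
Proof.
have bz := bounded_measurable_bform 1%:M (fun i => bounded_measurable_cst (x ord0 i)) z_bounded.
suff -> : qform Sg x = \int[Q]_y (bform 1%:M x (z y) ^+ 2).
  by apply: Rintegral_ge0 => y _; rewrite sqr_ge0.
have E y : bform 1%:M x (z y) ^+ 2 =
    \sum_i \sum_j (x ord0 j * x ord0 i) * (z y ord0 j * z y ord0 i).
  rewrite bformE mulmx1 expr2 big_distrl /= exchange_big /=.
  apply: eq_bigr => i _; rewrite big_distrr /= ; apply: eq_bigr => j _; ring.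
under eq_Rintegral do rewrite E.
rewrite mean_sum; last first.
  move=> i; apply: bounded_measurable_sum => j.
  apply: bounded_measurableM; first exact: bounded_measurable_cst.
  exact: bounded_measurableM.
rewrite bformE2; apply: eq_bigr => i _.
rewrite mean_sum; last first.
  move=> j; apply: bounded_measurableM; first exact: bounded_measurable_cst.
  exact: bounded_measurableM.
apply: eq_bigr => j _; rewrite meanZ; last exact: bounded_measurableM.
by rewrite z_cov mulrC.
Qed.

Let VT : V^T = V. Proof. by rewrite trmx_inv cov_sym. Qed.
Let V_ge0 x : 0 <= qform V x.
Proof. by rewrite qform_inv ?cov_sym// cov_ge0. Qed.

Definition partial_sum n w : 'rV[R]_N := \sum_(r < n) z (Y r w).

Lemma partial_sumS n w : partial_sum n.+1 w = partial_sum n w + z (Y n w).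
Proof. by rewrite /partial_sum big_ord_recr. Qed.

Lemma partial_sum_past n i :
  @bounded_measurable _ (g_sigma_algebraType (past_cylinders Y n)) R
    (fun w => partial_sum n w ord0 i).
Proof.
rewrite /partial_sum; under eq_fun do rewrite summxE.
by apply: bounded_measurable_sum => r; exact: (bounded_measurable_past Y (z_bounded i) (ltn_ord r)).
Qed.

Lemma bounded_measurable_gauss d0 (T : measurableType d0) (t : R) (x : T -> 'rV[R]_N) :
  0 <= t -> (forall i, bounded_measurable (fun w => x w ord0 i)) ->
  bounded_measurable (fun w => expR (- (t * qform V (x w)))).
Proof.
move=> t0 bx; have [mq _] := bounded_measurable_bform V bx bx.
apply: (@bounded_measurable_comp _ _ _ (fun q => expR (- (t * q))) _ 1) => //.
  apply: measurableT_comp => //; apply: measurableT_comp => //.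
move=> w; rewrite ger0_norm ?expR_ge0// expR_le1 oppr_le0 mulr_ge0//.
Qed.

(** Only the first two moments of the new term enter the expansion of a function of
    the sum to second order. *)
Lemma mean_second_order n (f : Omega -> R) a b c :
  @bounded_measurable _ (g_sigma_algebraType (past_cylinders Y n)) R f ->
  \int[P]_w (f w * (1 - a * bform V (partial_sum n w) (z (Y n w))
                     - b * qform V (z (Y n w))
                     + c * bform V (partial_sum n w) (z (Y n w)) ^+ 2)) =
  \int[P]_w (f w * (1 - b * N%:R + c * qform V (partial_sum n w))).
Proof.
move=> bf.
pose U w := partial_sum n w *m V.
have bU i : @bounded_measurable _ (g_sigma_algebraType (past_cylinders Y n)) R
    (fun w => U w ord0 i).
  under eq_fun do rewrite mxE.
  apply: bounded_measurable_sum => j; apply: bounded_measurableM.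
    exact: partial_sum_past.
  exact: bounded_measurable_cst.
have bz2 i j : bounded_measurable (fun y => z y ord0 i * z y ord0 j).
  exact: bounded_measurableM.
have bfW := bounded_measurable_pastW bf.
have bzn i : bounded_measurable (fun w => z (Y n w) ord0 i).
  exact: (bounded_measurable_now Y n (z_bounded i)).
have bUW i : bounded_measurable (fun w => partial_sum n w ord0 i).
  exact: (bounded_measurable_pastW (partial_sum_past n i)).
have bB := bounded_measurable_bform V bUW bzn.
have bq := bounded_measurable_bform V bzn bzn.
have bqU := bounded_measurable_bform V bUW bUW.
have bfB := bounded_measurableM bfW bB.
have bfq := bounded_measurableM bfW bq.
have bfB2 := bounded_measurableM bfW (bounded_measurableM bB bB).
have bfqU := bounded_measurableM bfW bqU.
have first0 : \int[P]_w (f w * bform V (partial_sum n w) (z (Y n w))) = 0.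
  have E w : f w * bform V (partial_sum n w) (z (Y n w)) =
      \sum_i (f w * U w ord0 i) * z (Y n w) ord0 i.
    by rewrite bformE big_distrr /=; apply: eq_bigr => i _; rewrite mulrA.
  have bfU i := bounded_measurableM bf (bU i).
  under eq_Rintegral do rewrite E.
  rewrite mean_sum; last first.
    by move=> i; apply: bounded_measurableM => //; exact: bounded_measurable_pastW.
  rewrite big1// => i _.
  rewrite (mean_mul_past Y_indep (bfU i) (z_bounded i)).
  by rewrite (mean_law Y_law n (z_bounded i)) z_mean0 mulr0.
have second1 : \int[P]_w (f w * qform V (z (Y n w))) = N%:R * \int[P]_w f w.
  have E w : f w * qform V (z (Y n w)) =
      \sum_i \sum_j V j i * (f w * (z (Y n w) ord0 j * z (Y n w) ord0 i)).
    rewrite bformE2 big_distrr /=; apply: eq_bigr => i _; rewrite big_distrr /=.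
    by apply: eq_bigr => j _; ring.
  have bfz i j : bounded_measurable (fun w => f w * (z (Y n w) ord0 j * z (Y n w) ord0 i)).
    by do 2 apply: bounded_measurableM => //.
  under eq_Rintegral do rewrite E.
  have -> : N%:R * \int[P]_w f w = \sum_i \sum_j V j i * (\int[P]_w f w * Sg j i).
    have -> : N%:R = \tr (1%:M : 'M[R]_N) by rewrite mxtrace1.
    rewrite -(mulVmx Sg_unit) -/V /mxtrace big_distrl /= exchange_big /=.
    rewrite exchange_big /=; apply: eq_bigr => i _; rewrite mxE big_distrl /=.
    apply: eq_bigr => j _; rewrite -[in V j i]VT mxE -[in Sg j i]cov_sym mxE; ring.
  rewrite mean_sum; last first.
    move=> i; apply: bounded_measurable_sum => j; apply: bounded_measurableM => //.
    exact: bounded_measurable_cst.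
  apply: eq_bigr => i _; rewrite mean_sum; last first.
    by move=> j; apply: bounded_measurableM => //; exact: bounded_measurable_cst.
  apply: eq_bigr => j _; rewrite meanZ//; congr (_ * _).
  by rewrite (mean_mul_past Y_indep bf (bz2 j i)) (mean_law Y_law n (bz2 j i)) z_cov.
have second2 : \int[P]_w (f w * (bform V (partial_sum n w) (z (Y n w)) *
      bform V (partial_sum n w) (z (Y n w)))) =
    \int[P]_w (f w * qform V (partial_sum n w)).
  have E w : f w * (bform V (partial_sum n w) (z (Y n w)) *
      bform V (partial_sum n w) (z (Y n w))) =
      \sum_i \sum_j (f w * (U w ord0 j * U w ord0 i)) *
        (z (Y n w) ord0 j * z (Y n w) ord0 i).
    rewrite bformE big_distrl /= big_distrr /= exchange_big /=.
    apply: eq_bigr => i _; rewrite big_distrr /= big_distrr /=.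
    by apply: eq_bigr => j _; rewrite /U; ring.
  have bfUU i j := bounded_measurableM bf (bounded_measurableM (bU j) (bU i)).
  have bfUUW i j := bounded_measurable_pastW (bfUU i j).
  have bzz i j := bounded_measurableM (bzn j) (bzn i).
  under eq_Rintegral do rewrite E.
  have E' w : f w * qform V (partial_sum n w) =
      \sum_i \sum_j Sg j i * (f w * (U w ord0 j * U w ord0 i)).
    rewrite qform_inv ?cov_sym// bformE2 big_distrr /=; apply: eq_bigr => i _.
    by rewrite big_distrr /=; apply: eq_bigr => j _; rewrite /U; ring.
  under [RHS]eq_Rintegral do rewrite E'.
  rewrite !mean_sum; last 2 first.
  - move=> i; apply: bounded_measurable_sum => j; apply: bounded_measurableM => //.
    exact: bounded_measurable_cst.
  - by move=> i; apply: bounded_measurable_sum => j; apply: bounded_measurableM.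
  apply: eq_bigr => i _; rewrite !mean_sum; last 2 first.
  - by move=> j; apply: bounded_measurableM => //; exact: bounded_measurable_cst.
  - by move=> j; apply: bounded_measurableM.
  apply: eq_bigr => j _; rewrite meanZ//.
  by rewrite (mean_mul_past Y_indep (bfUU i j) (bz2 j i)) (mean_law Y_law n (bz2 j i)) z_cov mulrC.
have EL w : f w * (1 - a * bform V (partial_sum n w) (z (Y n w))
     - b * qform V (z (Y n w)) + c * bform V (partial_sum n w) (z (Y n w)) ^+ 2) =
   f w - (a * (f w * bform V (partial_sum n w) (z (Y n w))) +
          b * (f w * qform V (z (Y n w)))) +
   c * (f w * (bform V (partial_sum n w) (z (Y n w)) *
               bform V (partial_sum n w) (z (Y n w)))) by ring.
have ER w : f w * (1 - b * N%:R + c * qform V (partial_sum n w)) =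
   (1 - b * N%:R) * f w + c * (f w * qform V (partial_sum n w)) by ring.
under eq_Rintegral do rewrite EL.
under [RHS]eq_Rintegral do rewrite ER.
have bZ (r : R) (g : Omega -> R) : bounded_measurable g ->
    bounded_measurable (fun w : Omega => r * g w).
  by move=> bg; apply: bounded_measurableM => //; exact: bounded_measurable_cst.
have b1 := bounded_measurableD (bZ a _ bfB) (bZ b _ bfq).
rewrite (meanD P (bounded_measurableB bfW b1) (bZ c _ bfB2)) (meanB P bfW b1).
rewrite (meanD P (bZ a _ bfB) (bZ b _ bfq)) (meanD P (bZ (1 - b * N%:R) _ bfW) (bZ c _ bfqU)).
by rewrite !meanZ// first0 second1 second2; ring.
Qed.

Definition gauss_mean (t : R) n := \int[P]_w expR (- (t * qform V (partial_sum n w))).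

Lemma qform_bounded : exists2 C : R, 0 <= C & forall y, qform V (z y) <= C.
Proof.
have [_ [B hB]] := bounded_measurable_bform V z_bounded z_bounded.
exists `|B|; first by [].
by move=> y; rewrite (le_trans (ler_norm _))// (le_trans (hB y))// ler_norm.
Qed.

(** Adding one term multiplies the Gaussian mean by a normalising factor and flattens
    the Gaussian, as adding an independent normal vector would do exactly. *)
Lemma gauss_mean_step : exists2 C : R, 0 <= C & forall n (t : R),
  0 <= t <= 1 -> t * C <= 1 ->
  `|gauss_mean t n.+1 - chi_factor t ^+ N * gauss_mean (t / (1 + 2 * t)) n| <=
    C * (t * Num.sqrt t).
Proof.
have [C1 C10 hC1] := qform_bounded.
have [C2 C20 hC2] := @gauss_rescaling_approx R N.
have C30 := sqrtr_ge0 C1.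
pose C := C1 + 244 * (C1 * Num.sqrt C1) + C2.
have CC30 : 0 <= C1 * Num.sqrt C1 by exact: mulr_ge0.
have C0 : 0 <= C by rewrite /C; lra.
exists C => // n t t01 tC.
have /andP[t0 t1] := t01.
have st0 := sqrtr_ge0 t.
have tC1 : t * C1 <= 1.
  by apply: le_trans tC; rewrite ler_wpM2l// /C; lra.
have bU i := bounded_measurable_pastW (partial_sum_past n i).
have bS i := bounded_measurable_pastW (partial_sum_past n.+1 i).
have bz i := bounded_measurable_now Y n (z_bounded i).
have bB := bounded_measurable_bform V bU bz.
have bqz := bounded_measurable_bform V bz bz.
have bqU := bounded_measurable_bform V bU bU.
have bgS := bounded_measurable_gauss t0 bS.
have bg := bounded_measurable_gauss t0 (partial_sum_past n).
have bgW := bounded_measurable_pastW bg.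
have t'0 : 0 <= t / (1 + 2 * t) by rewrite divr_ge0//; lra.
have bg' := bounded_measurable_gauss t'0 bU.
have bc (r : R) : bounded_measurable (fun _ : Omega => r) := bounded_measurable_cst r.
have bM := @bounded_measurableM _ Omega R.
pose f w := expR (- (t * qform V (partial_sum n w))).
pose g w := f w * (1 - 2 * t * bform V (partial_sum n w) (z (Y n w))
  - t * qform V (z (Y n w)) + 2 * t ^+ 2 * bform V (partial_sum n w) (z (Y n w)) ^+ 2).
have bgg : bounded_measurable g.
  exact: (bM _ _ bgW (bounded_measurableD (bounded_measurableB (bounded_measurableB
    (bc 1) (bM _ _ (bc _) bB)) (bM _ _ (bc _) bqz)) (bM _ _ (bc _) (bM _ _ bB bB)))).
pose h w := f w * (1 - t * N%:R + 2 * t ^+ 2 * qform V (partial_sum n w)).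
have bh : bounded_measurable h.
  exact: (bM _ _ bgW (bounded_measurableD (bc _) (bM _ _ (bc _) bqU))).
have gh : \int[P]_w g w = \int[P]_w h w by exact: mean_second_order.
pose e0 := 244 * (C1 * Num.sqrt C1) * (t * Num.sqrt t).
have step1 : `|gauss_mean t n.+1 - \int[P]_w g w| <= e0.
  rewrite -meanB//; apply: mean_norm_le; first exact: bounded_measurableB.
  move=> w; set x := partial_sum n w; set y := z (Y n w).
  have qx := V_ge0 x; have qy := V_ge0 y.
  have ty0 : 0 <= t * qform V y by exact: mulr_ge0.
  have ty : t * qform V y <= t * C1 by rewrite ler_wpM2l// hC1.
  pose e := Num.sqrt (t * qform V y).
  have e2 : e ^+ 2 = t * qform V y by rewrite sqr_sqrtr.
  have eC : e <= Num.sqrt C1 * Num.sqrt t by rewrite -sqrtrM// ler_wsqrtr// (mulrC C1).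
  have e01 : 0 <= e <= 1 by rewrite sqrtr_ge0 -[leRHS]sqrtr1 ler_wsqrtr// (le_trans ty).
  have := @gauss_increment R (t * qform V x) (t * qform V (x + y)) (t * bform V x y) e
    (mulr_ge0 t0 qx) (mulr_ge0 t0 (V_ge0 _)) e01.
  rewrite e2 qformD// => H.
  have -> : g w = expR (- (t * qform V x)) *
     (1 - 2 * (t * bform V x y) - t * qform V y + 2 * (t * bform V x y) ^+ 2).
    by rewrite /g /f -/x -/y; congr (_ * _); ring.
  rewrite partial_sumS -/x -/y qformD//; apply: (le_trans (H _ _)); first by ring.
    rewrite exprMn [leRHS]mulrACA -[t * t]expr2; apply: ler_wpM2l; first exact: sqr_ge0.
    exact: bform_cauchy_schwarz.
  rewrite /e0 -[leRHS]mulrA ler_pM2l//.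
  have -> : C1 * Num.sqrt C1 * (t * Num.sqrt t) = (Num.sqrt C1 * Num.sqrt t) ^+ 3.
    by rewrite -{1}(sqr_sqrtr C10) -{1}(sqr_sqrtr t0); ring.
  by rewrite lerXn2r ?nnegrE ?mulr_ge0// sqrtr_ge0.
have step2 : `|\int[P]_w h w - chi_factor t ^+ N * gauss_mean (t / (1 + 2 * t)) n| <=
    C2 * (t * Num.sqrt t).
  have bcg : bounded_measurable (fun w => chi_factor t ^+ N *
      expR (- (t / (1 + 2 * t) * qform V (partial_sum n w)))) by exact: (bM _ _ (bc _) bg').
  rewrite -meanZ// -meanB//; apply: mean_norm_le; first exact: bounded_measurableB.
  move=> w; set x := partial_sum n w.
  have := hC2 t (t * qform V x) t01 (mulr_ge0 t0 (V_ge0 x)).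
  have -> : t * qform V x / (1 + 2 * t) = t / (1 + 2 * t) * qform V x by rewrite mulrAC.
  have -> : expR (- (t * qform V x)) * (1 - N%:R * t + 2 * t * (t * qform V x)) = h w.
    by rewrite /h /f -/x; congr (_ * _); ring.
  move=> /le_trans; apply; rewrite ler_wpM2l// expr2 ler_wpM2l//.
  rewrite -[leLHS](sqr_sqrtr t0) expr2 ler_piMr// -[leRHS]sqrtr1.
  exact: ler_wsqrtr.
rewrite (le_trans (ler_distD (\int[P]_w g w) _ _))//.
apply: (le_trans (lerD step1 (_ : _ <= C2 * (t * Num.sqrt t)))); first by rewrite gh.
have tst : 0 <= t * Num.sqrt t by exact: mulr_ge0.
rewrite /e0 /C -mulrDl ler_wpM2r//; lra.
Qed.

Lemma gauss_mean_approx : exists2 C : R, 0 <= C & forall n (t : R),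
  0 <= t <= 1 -> t * C <= 1 ->
  `|gauss_mean t n - chi_factor (n%:R * t) ^+ N| <= n%:R * (C * (t * Num.sqrt t)).
Proof.
have [C C0 hC] := gauss_mean_step.
exists C => // n; elim: n => [|n IH] t t01 tC.
  rewrite mul0r /gauss_mean /partial_sum.
  under eq_Rintegral do rewrite big_ord0 /bform !mul0mx mxE mulr0 oppr0 expR0.
  by rewrite mean_cst /chi_factor mulr0 addr0 sqrtr1 invr1 expr1n subrr normr0 mul0r.
have /andP[t0 t1] := t01.
have d0 : 0 < 1 + 2 * t by lra.
have t't : t / (1 + 2 * t) <= t by rewrite ler_pdivrMr// ler_peMr//; lra.
have t'0 : 0 <= t / (1 + 2 * t) by rewrite divr_ge0// ltW.
have t'01 : 0 <= t / (1 + 2 * t) <= 1 by rewrite t'0 (le_trans t't).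
have t'C : t / (1 + 2 * t) * C <= 1 by rewrite (le_trans _ tC)// ler_wpM2r.
have := IH _ t'01 t'C; have := hC n t t01 tC.
set t' := t / (1 + 2 * t) in t't t'0 t'01 t'C *.
have -> : chi_factor (n.+1%:R * t) = chi_factor t * chi_factor (n%:R * t').
  by rewrite /t' mulrA chi_factorM ?mulr_ge0// -natr1 mulrDl mul1r.
rewrite exprMn; set c := chi_factor t ^+ N; set c' := chi_factor _ ^+ N.
have c0 : 0 <= c by rewrite exprn_ge0// ltW// chi_factor_gt0.
have c1 : c <= 1 by rewrite exprn_ile1 ?chi_factor_le1// ltW// chi_factor_gt0.
have h3 : t' * Num.sqrt t' <= t * Num.sqrt t.
  by rewrite ler_pM ?sqrtr_ge0// ler_wsqrtr.
move: (gauss_mean t n.+1) (gauss_mean t' n) => G G' h1 h2.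
have -> : G - c * c' = (G - c * G') + c * (G' - c') by ring.
apply: (le_trans (ler_normD _ _)).
rewrite normrM (ger0_norm c0) -natr1 mulrDl mul1r addrC lerD//.
rewrite (le_trans (ler_piMl _ c1))// (le_trans h2)//.
by rewrite ler_wpM2l// ler_wpM2l.
Qed.

(** The error of one step is of order [(t / n) ^ (3/2)], and there are [n] steps. *)
Lemma laplace_clt (t : R) : 0 <= t ->
  (fun n => gauss_mean (t / n%:R) n) @ \oo --> chi_factor t ^+ N.
Proof.
move=> t0; have [C C0 hC] := gauss_mean_approx.
have cv0 : (fun n => t / n%:R : R) @ \oo --> 0.
  by rewrite -[X in _ --> X](mulr0 t); apply: cvgMl_tmp; exact: cvg_invn.
apply/cvgrPdist_le => e e0.
have cv1 : (fun n => C * (t * Num.sqrt (t / n%:R))) @ \oo --> 0.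
  rewrite -[X in _ --> X](mulr0 C); apply: cvgMl_tmp.
  rewrite -[X in _ --> X](mulr0 t); apply: cvgMl_tmp.
  rewrite -(sqrtr0 R); apply: continuous_cvg => //; exact: sqrt_continuous.
move/cvgrPdist_le : cv1 => /(_ e e0) cv1.
near=> n.
have n0 : 0 < n%:R :> R by rewrite ltr0n; near: n; exact: nbhs_infty_gt.
have tn0 : 0 <= t / n%:R by rewrite divr_ge0.
have tn1 : t / n%:R <= 1.
  by rewrite ler_pdivrMr// mul1r; near: n; exact: nbhs_infty_ger.
have tnC : t / n%:R * C <= 1.
  rewrite mulrAC ler_pdivrMr// mul1r; near: n; exact: nbhs_infty_ger.
have := hC n (t / n%:R); rewrite tn0 tn1 => /(_ isT tnC).
have -> : n%:R * (t / n%:R) = t by rewrite mulrC divfK// gt_eqF.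
rewrite distrC => /le_trans; apply.
have -> : n%:R * (C * (t / n%:R * Num.sqrt (t / n%:R))) = C * (t * Num.sqrt (t / n%:R)).
  by field; rewrite gt_eqF.
have : `|0 - C * (t * Num.sqrt (t / n%:R))| <= e by near: n.
by rewrite sub0r normrN; apply: le_trans; exact: ler_norm.
Unshelve. all: by end_near.
Qed.

End laplace_clt.

(** * The Laplace transform of the chi-square law *)

Section chi_square_laplace.
Context {R : realType}.
Local Open Scope ereal_scope.

(** The density is the Radon-Nikodym derivative, by uniqueness of the latter. *)
Lemma ge0_integral_normal_prob (m s : R) (f : measurableTypeR R -> \bar R) :
  measurable_fun setT f -> (forall x, 0 <= f x) ->
  \int[normal_prob m s]_x f x = \int[lebesgue_measure]_x (f x * (normal_pdf m s x)%:E).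
Proof.
move=> mf f0.
rewrite -(Radon_Nikodym_SigmaFinite.change_of_variables (normal_prob_dominates m s))//.
have mpdf : measurable_fun setT (fun x : measurableTypeR R => (normal_pdf m s x)%:E).
  by apply/measurable_EFinP; exact: measurable_normal_pdf.
have iRN := Radon_Nikodym_SigmaFinite.f_integrable (normal_prob_dominates m s).
apply: ae_eq_integral => //.
- by apply: emeasurable_funM => //; exact: measurable_int iRN.
- exact: emeasurable_funM.
apply: ae_eqe_mul2l; apply: integral_ae_eq => // A _ mA.
by rewrite -(Radon_Nikodym_SigmaFinite.f_integral (normal_prob_dominates m s)).
Qed.

Lemma measurable_gauss_sqr (t : R) :
  measurable_fun setT (fun z : measurableTypeR R => (expR (- (t * z ^+ 2)))%:E).
Proof.
apply/measurable_EFinP; apply: measurableT_comp => //.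
apply: measurableT_comp => //; apply: measurable_funM => //.
Qed.

(** Multiplying the standard normal density by [exp (- t z ^+ 2)] only changes its
    variance, from 1 to [chi_factor t ^+ 2], and its total mass. *)
Lemma normal_sqr_laplace (t : R) : (0 <= t)%R ->
  \int[normal_prob 0 1]_z (expR (- (t * z ^+ 2)))%:E = (chi_factor t)%:E.
Proof.
move=> t0.
have s0 := chi_factor_gt0 t0; have s2 := chi_factor_sqr t0.
set s := chi_factor t in s0 s2 *.
have sN0 : (s != 0)%R by rewrite gt_eqF.
have mf : measurable_fun setT (fun z : measurableTypeR R => (expR (- (t * z ^+ 2)))%:E).
  exact: measurable_gauss_sqr.
have f0 (z : measurableTypeR R) : 0 <= (expR (- (t * z ^+ 2)))%:E.
  by rewrite lee_fin expR_ge0.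
rewrite (ge0_integral_normal_prob _ _ mf f0).
under eq_integral => z _.
  have -> : ((expR (- (t * z ^+ 2)))%:E * (normal_pdf 0 1 z)%:E)%E =
      (s%:E * (normal_pdf 0 s z)%:E)%E.
    rewrite -!EFinM; congr EFin.
    rewrite !normal_pdfE// ?oner_neq0//= /normal_peak /normal_fun !subr0.
    have -> : (- z ^+ 2 / (s ^+ 2 *+ 2) = - (t * z ^+ 2) + - z ^+ 2 / (1 ^+ 2 *+ 2))%R.
      have -> : (s ^+ 2 = (1 + 2 * t)^-1)%R.
        by apply: (mulIf (lt0r_neq0 (_ : 0 < 1 + 2 * t)%R)); rewrite ?s2 ?mulVf// ?gt_eqF//; lra.
      by field; lra.
    rewrite expr1n mul1r expRD -[(s ^+ 2 * pi *+ 2)%R]mulrnAr sqrtrM ?sqr_ge0//.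
    rewrite sqrtr_sqr (gtr0_norm s0) invfM; field.
    by rewrite sN0 andbT gt_eqF// sqrtr_gt0 mulrn_wgt0// pi_gt0.
  over.
have mpdf : measurable_fun setT (fun z : measurableTypeR R => (normal_pdf 0 s z)%:E).
  by apply/measurable_EFinP; exact: measurable_normal_pdf.
have pdf0 (z : measurableTypeR R) : setT z -> 0 <= (normal_pdf 0 s z)%:E.
  by rewrite lee_fin normal_pdf_ge0.
apply: etrans (ge0_integralZl _ measurableT mpdf pdf0 _) _; first by rewrite lee_fin ltW.
by rewrite integral_normal_pdf mule1.
Qed.

Lemma integral_chi_squareS k (f : R -> \bar R) : measurable_fun setT f ->
  (forall x, 0 <= f x) ->
  \int[chi_square R k.+1]_x f x =
  \int[chi_square R k]_x \int[normal_prob 0 1]_z f (x + z ^+ 2)%R.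
Proof.
move=> mf f0 /=.
rewrite ge0_integral_distribution// fubini_tonelli1//=.
apply: measurableT_comp => //; exact: measurable_add_sqr.
Qed.

Lemma chi_square_laplace k (t : R) : (0 <= t)%R ->
  \int[chi_square R k]_x (expR (- (t * x)))%:E = (chi_factor t ^+ k)%:E.
Proof.
move=> t0.
have me (u : R) : measurable_fun setT (fun x : R => (expR (- (u * x)))%:E).
  apply/measurable_EFinP; apply: measurableT_comp => //.
  by apply: measurableT_comp => //.
elim: k => [|k IH].
  by rewrite integral_dirac// diracT mul1e mulr0 oppr0 expR0 expr0.
rewrite integral_chi_squareS//.
transitivity (\int[chi_square R k]_x ((chi_factor t)%:E * (expR (- (t * x)))%:E)).
  apply: eq_integral => x _.
  under eq_integral do rewrite mulrDr opprD expRD EFinM.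
  have z0 (z : measurableTypeR R) : setT z -> 0 <= (expR (- (t * z ^+ 2)))%:E.
    by rewrite lee_fin expR_ge0.
  apply: etrans (ge0_integralZl _ measurableT (measurable_gauss_sqr t) z0 _) _.
    by rewrite lee_fin expR_ge0.
  by rewrite normal_sqr_laplace// muleC.
have x0 (x : R) : setT x -> 0 <= (expR (- (t * x)))%:E by rewrite lee_fin expR_ge0.
apply: etrans (ge0_integralZl _ measurableT (me t) x0 _) _.
  by rewrite lee_fin ltW// chi_factor_gt0.
by rewrite IH -EFinM exprS.
Qed.

Lemma chi_square_neg k : chi_square R k [set x | (x < 0)%R] = 0.
Proof.
elim: k => [|k IH].
  by rewrite /= diracE memNset//= ltxx.
set A := [set x : R | (x < 0)%R] in IH *.
have mA : measurable A by rewrite -[X in measurable X]setTI; exact: measurable_fun_ltr.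
have mf : measurable_fun setT (fun x : R => (\1_A x : R)%:E).
  by apply/measurable_EFinP; exact: measurable_indic.
have f0 (x : R) : 0 <= (\1_A x : R)%:E by rewrite lee_fin.
have E j : chi_square R j A = \int[chi_square R j]_x (\1_A x : R)%:E.
  by rewrite integral_indic// setIT.
apply/eqP; rewrite eq_le measure_ge0 andbT -IH !E integral_chi_squareS//.
have mF : measurable_fun setT (fun p : R * measurableTypeR R => (\1_A (add_sqr p) : R)%:E).
  apply: (measurableT_comp mf); exact: measurable_add_sqr.
apply: ge0_le_integral => //.
- by move=> x _; exact: integral_ge0.
- have := measurable_fun_fubini_tonelli_F (m2 := normal_prob (0 : R) 1) _ mF.
  by apply.
move=> x _.
have -> : (\1_A x : R)%:E = \int[normal_prob (0 : R) 1]_z (\1_A x : R)%:E.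
  rewrite integral_cst// [X in _ * X](_ : _ = 1) ?mule1//.
  exact: (probability_setT (normal_prob (0 : R) 1)).
apply: ge0_le_integral => //.
- apply: (measurableT_comp mf); exact: measurable_funD.
- move=> z _; rewrite lee_fin !indicE ler_nat.
  case: (boolP (x \in A)) => [_|]; first exact: leq_b1.
  rewrite !notin_setE /A /= => /negP; rewrite -leNgt => x0.
  by rewrite memNset//= ltNge addr_ge0// sqr_ge0.
Qed.

(** Lets the nonnegativity that [laplace_determines_law] encodes with an absolute value be
    dropped. *)
Lemma chi_square_abs k (f : R -> R) : measurable_fun setT f ->
  (\int[chi_square R k]_x (f `|x|%R)%:E = \int[chi_square R k]_x (f x)%:E).
Proof.
move=> mf; apply: ae_eq_integral => //.
- by apply/measurable_EFinP; apply: measurableT_comp => //; exact: measurableT_comp.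
- exact/measurable_EFinP.
exists [set x | (x < 0)%R]; split; [|exact: chi_square_neg|].
  by rewrite -[X in measurable X]setTI; exact: measurable_fun_ltr.
move=> x /= /not_implyP[_ h]; rewrite ltNge; apply/negP => x0; apply: h.
by rewrite ger0_norm.
Qed.

End chi_square_laplace.

(** * Eigenvectors of a perturbed symmetric matrix *)

Section dot_product.
Context {R : realType} {k : nat}.
Implicit Types (u v w : 'cV[R]_k) (a : R).

Lemma dotvE u v : dotv u v = \sum_i u i ord0 * v i ord0.
Proof. by rewrite /dotv mxE; apply: eq_bigr => i _; rewrite mxE. Qed.

Lemma dotvC u v : dotv u v = dotv v u.
Proof. by rewrite !dotvE; apply: eq_bigr => i _; rewrite mulrC. Qed.

Lemma dotvDl u v w : dotv (u + v) w = dotv u w + dotv v w.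
Proof. by rewrite /dotv raddfD/= mulmxDl mxE. Qed.

Lemma dotvZl a u v : dotv (a *: u) v = a * dotv u v.
Proof. by rewrite /dotv linearZ/= -scalemxAl mxE. Qed.

Lemma dotvBl u v w : dotv (u - v) w = dotv u w - dotv v w.
Proof. by rewrite dotvDl -scaleN1r dotvZl mulN1r. Qed.

Lemma dotvZr a u v : dotv u (a *: v) = a * dotv u v.
Proof. by rewrite dotvC dotvZl dotvC. Qed.

Lemma dotvBr u v w : dotv w (u - v) = dotv w u - dotv w v.
Proof. by rewrite dotvC dotvBl !(dotvC w). Qed.

Lemma dotv_suml (I : finType) (F : I -> 'cV[R]_k) v :
  dotv (\sum_i F i) v = \sum_i dotv (F i) v.
Proof. by rewrite /dotv raddf_sum/= mulmx_suml summxE. Qed.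

Lemma dotv_sumr (I : finType) (F : I -> 'cV[R]_k) v :
  dotv v (\sum_i F i) = \sum_i dotv v (F i).
Proof. by rewrite dotvC dotv_suml; apply: eq_bigr => i _; rewrite dotvC. Qed.

Lemma dotv_ge0 u : 0 <= dotv u u.
Proof. by rewrite dotvE sumr_ge0// => i _; rewrite -expr2 sqr_ge0. Qed.

Lemma dotv_sqr_le u v : dotv u v ^+ 2 <= dotv u u * dotv v v.
Proof.
have E (x y : 'cV[R]_k) : dotv x y = bform 1%:M x^T y^T.
  by rewrite /dotv /bform mulmx1 trmxK.
rewrite !E; apply: bform_cauchy_schwarz; first exact: trmx1.
by move=> z; rewrite -[z]trmxK -E dotv_ge0.
Qed.

Lemma dotv_unit_le1 u v : dotv u u = 1 -> dotv v v = 1 -> `|dotv u v| <= 1.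
Proof.
move=> u1 v1; have := dotv_sqr_le u v; rewrite u1 v1 mulr1 => h.
by rewrite -(@expr_le1 _ 2)// real_normK// num_real.
Qed.

End dot_product.

Section eigensystems.
Context {R : realType} {k : nat}.
Variables (A : 'M[R]_k) (lam : 'I_k -> R) (gam : 'I_k -> 'cV[R]_k).
Hypothesis Agam : eigensystem A lam gam.

(** An orthonormal family of full size is also complete: a left inverse of a square matrix
    is a right inverse. *)
Lemma eigenvectors_complete : \sum_a gam a *m (gam a)^T = 1%:M.
Proof.
have [_ orth _] := Agam.
pose B : 'M[R]_k := \matrix_(i, a) gam a i ord0.
have BB : B^T *m B = 1%:M.
  apply/matrixP => a b; rewrite !mxE -orth dotvE.
  by apply: eq_bigr => i _; rewrite !mxE.
have <- : B *m B^T = 1%:M by exact: mulmx1C.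
apply/matrixP => i j; rewrite summxE mxE; apply: eq_bigr => a _.
by rewrite !mxE big_ord1 !mxE.
Qed.

Lemma eigenvectors_expand u : u = \sum_a dotv (gam a) u *: gam a.
Proof.
rewrite -{1}[u]mul1mx -eigenvectors_complete mulmx_suml.
apply: eq_bigr => a _; rewrite -mulmxA.
rewrite [(gam a)^T *m u](_ : _ = (dotv (gam a) u)%:M) ?mul_mx_scalar//.
by apply/matrixP => i j; rewrite !ord1 [RHS]mxE mulr1n.
Qed.

Lemma parseval u v : dotv u v = \sum_a dotv (gam a) u * dotv (gam a) v.
Proof.
rewrite {1}[u]eigenvectors_expand dotv_suml.
by apply: eq_bigr => a _; rewrite dotvZl.
Qed.

Lemma spectral_form u v : dotv u (A *m v) = \sum_a lam a * (dotv (gam a) u * dotv (gam a) v).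
Proof.
have [_ _ eig] := Agam.
rewrite {1}[v]eigenvectors_expand mulmx_sumr dotv_sumr; apply: eq_bigr => a _.
by rewrite -scalemxAr eig !dotvZr (dotvC u); ring.
Qed.

Lemma eigenvector_norm a : dotv (gam a) (gam a) = 1.
Proof. by have [_ orth _] := Agam; rewrite orth eqxx. Qed.

End eigensystems.

(** [lam] and [gam] are the eigenvalues and eigenvectors of [A], and [d] and [g] those of
    an entrywise perturbation [J] of [A]. *)
Section eigenvector_perturbation.
Context {R : realType} {m : nat}.
Variables (A J : 'M[R]_m.+1) (lam d : 'I_m.+1 -> R) (gam g : 'I_m.+1 -> 'cV[R]_m.+1).
Hypothesis Agam : eigensystem A lam gam.
Hypothesis Jg : eigensystem J d g.
Variables (gap e : R).
Hypothesis gap_gt0 : 0 < gap.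
Hypothesis lam_gap : forall a, a != ord_max -> lam a + gap <= lam ord_max.
Hypothesis AJ : forall i j, `|J i j - A i j| <= e.

Let K : R := m.+1%:R ^+ 2.

Lemma unit_form_close u : dotv u u = 1 -> `|dotv u (J *m u) - dotv u (A *m u)| <= K * e.
Proof.
move=> u1; rewrite -dotvBr -mulmxBl.
have ui i : `|u i ord0| <= 1.
  rewrite -(@expr_le1 _ 2)// real_normK ?num_real// -u1 dotvE (bigD1 i)//=.
  by rewrite -expr2 lerDl sumr_ge0// => j _; rewrite -expr2 sqr_ge0.
rewrite dotvE; apply: (@le_trans _ _ (\sum_(i < m.+1) \sum_(j < m.+1) e)).
  apply: (le_trans (ler_norm_sum _ _ _)); apply: ler_sum => i _.
  rewrite normrM mxE; apply: (@le_trans _ _ (`|\sum_j (J - A) i j * u j ord0|)).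
    by rewrite ler_piMl.
  apply: (le_trans (ler_norm_sum _ _ _)); apply: ler_sum => j _.
  rewrite normrM; apply: (@le_trans _ _ (`|(J - A) i j|)).
    by rewrite ler_piMr.
  by have := AJ i j; rewrite !mxE.
by rewrite !sumr_const !card_ord /K -[e *+ _]mulr_natl -mulr_natl; lra.
Qed.

(** A unit vector on which the form of [J] is as large as on [gam ord_max] has, up to
    the perturbation, a form of [A] as large as [lam ord_max], and each part of it
    orthogonal to [gam ord_max] costs [gap]. *)
Lemma near_maximizer_close h : dotv h h = 1 ->
  dotv (gam ord_max) (J *m gam ord_max) <= dotv h (J *m h) ->
  gap * (1 - dotv (gam ord_max) h ^+ 2) <= 2 * (K * e).
Proof.
move=> h1 hJ; set c := dotv _ h.
have g1 := eigenvector_norm Agam ord_max.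
have Ag : dotv (gam ord_max) (A *m gam ord_max) = lam ord_max.
  by have [_ _ ->] := Agam; rewrite dotvZr g1 mulr1.
have Ah : dotv h (A *m h) <= lam ord_max - gap * (1 - c ^+ 2).
  rewrite (spectral_form Agam).
  have hE : 1 = \sum_a dotv (gam a) h ^+ 2.
    by rewrite -h1 (parseval Agam); apply: eq_bigr => a _.
  rewrite [leRHS](_ : _ = (lam ord_max - gap) * \sum_a dotv (gam a) h ^+ 2 +
      gap * c ^+ 2); last first.
    by rewrite -hE; ring.
  rewrite (bigD1 ord_max)//= [X in _ <= _ * X + _](bigD1 ord_max)//= -/c.
  have : \sum_(i | i != ord_max) lam i * (dotv (gam i) h * dotv (gam i) h) <=
      (lam ord_max - gap) * \sum_(i | i != ord_max) dotv (gam i) h ^+ 2.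
    rewrite big_distrr /=; apply: ler_sum => a aN; rewrite -expr2.
    by rewrite ler_wpM2r ?sqr_ge0// lerBrDr lam_gap.
  by rewrite mulrDr expr2; lra.
have := unit_form_close h1; have := unit_form_close g1.
rewrite !ler_norml Ag => /andP[k1 k2] /andP[k3 k4]; lra.
Qed.

Lemma sample_form_max : dotv (gam ord_max) (J *m gam ord_max) <= d ord_max.
Proof.
have [mono _ _] := Jg.
rewrite (spectral_form Jg).
have <- : d ord_max * \sum_a (dotv (g a) (gam ord_max) * dotv (g a) (gam ord_max)) = d ord_max.
  by rewrite -(parseval Jg) (eigenvector_norm Agam) mulr1.
rewrite big_distrr /=; apply: ler_sum => a _; rewrite -expr2 ler_wpM2r ?sqr_ge0//.
by apply: mono; rewrite -ltnS ltn_ord.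
Qed.

(** Stated for every eigenvector of the largest eigenvalue, as multiplicity one is only a
    consequence. *)
Lemma sample_eigenvector_close a : d a = d ord_max ->
  gap * (1 - dotv (gam ord_max) (g a) ^+ 2) <= 2 * (K * e).
Proof.
move=> da; apply: near_maximizer_close; first exact: (eigenvector_norm Jg).
have [_ _ ->] := Jg; rewrite dotvZr (eigenvector_norm Jg) mulr1 da.
exact: sample_form_max.
Qed.

(** Two orthonormal vectors cannot both be close to [gam ord_max]. *)
Lemma sample_eigenvalue_simple a : 4 * (K * e) < gap -> a != ord_max -> d a != d ord_max.
Proof.
move=> eg aN; apply/eqP => da.
have h1 := sample_eigenvector_close da; have h2 := sample_eigenvector_close (erefl (d ord_max)).
have := eigenvector_norm Agam ord_max.
rewrite (parseval Jg) (bigD1 ord_max)//= (bigD1 a)//= -!expr2.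
rewrite !(dotvC (g _) (gam ord_max)).
have : 0 <= \sum_(i | (i != ord_max) && (i != a))
    dotv (g i) (gam ord_max) * dotv (g i) (gam ord_max).
  by apply: sumr_ge0 => i _; rewrite -expr2 sqr_ge0.
set S := \sum_(i | _) _.
move: h1 h2; set x := dotv _ (g a); set y := dotv _ (g ord_max) => h1 h2 S0 E.
have : 0 <= gap * (1 - x ^+ 2 - y ^+ 2) by rewrite mulr_ge0 ?(ltW gap_gt0)//; lra.
by lra.
Qed.

(** Between unit vectors at an angle of nonnegative cosine [c], the squared distance
    [2 * (1 - c)] is at most [2 * (1 - c ^+ 2)]. *)
Lemma oriented_eigenvector_close : 0 <= dotv (gam ord_max) (g ord_max) ->
  gap * dotv (g ord_max - gam ord_max) (g ord_max - gam ord_max) <= 4 * (K * e).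
Proof.
move=> c0; have h := sample_eigenvector_close (erefl (d ord_max)).
have c1 := dotv_unit_le1 (eigenvector_norm Agam ord_max) (eigenvector_norm Jg ord_max).
rewrite dotvBl !dotvBr (eigenvector_norm Agam) (eigenvector_norm Jg).
rewrite (dotvC (g _)); move: h c0 c1; set c := dotv _ _ => h c0.
rewrite ger0_norm// => c1.
by have : gap * (1 - c) <= gap * (1 - c ^+ 2) by [rewrite ler_pM2l//; nra]; lra.
Qed.

End eigenvector_perturbation.

(** * Perturbation of the inverse matrix *)

Section inverse_perturbation.
Context {R : realType}.

(** The sum of the absolute values of the entries, a submultiplicative norm. *)
Definition mxsum m n (A : 'M[R]_(m, n)) : R := \sum_i \sum_j `|A i j|.

Lemma mxsum_ge0 m n (A : 'M[R]_(m, n)) : 0 <= mxsum A.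
Proof. by apply: sumr_ge0 => i _; apply: sumr_ge0. Qed.

Lemma mxsum_entry m n (A : 'M[R]_(m, n)) i j : `|A i j| <= mxsum A.
Proof.
rewrite /mxsum (bigD1 i)//= (bigD1 j)//= -addrA lerDl addr_ge0//.
  by apply: sumr_ge0.
by apply: sumr_ge0 => i' _; apply: sumr_ge0.
Qed.

Lemma mxsumD m n (A B : 'M[R]_(m, n)) : mxsum (A + B) <= mxsum A + mxsum B.
Proof.
rewrite /mxsum -big_split; apply: ler_sum => i _; rewrite -big_split.
by apply: ler_sum => j _; rewrite mxE ler_normD.
Qed.

Lemma mxsumN m n (A : 'M[R]_(m, n)) : mxsum (- A) = mxsum A.
Proof. by apply: eq_bigr => i _; apply: eq_bigr => j _; rewrite mxE normrN. Qed.

Lemma mxsumM m n p (A : 'M[R]_(m, n)) (B : 'M[R]_(n, p)) :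
  mxsum (A *m B) <= mxsum A * mxsum B.
Proof.
rewrite /mxsum big_distrl /=; apply: ler_sum => i _.
apply: (@le_trans _ _ (\sum_j \sum_k `|A i k| * `|B k j|)).
  apply: ler_sum => j _; rewrite mxE (le_trans (ler_norm_sum _ _ _))//.
  by apply: ler_sum => k _; rewrite normrM.
rewrite exchange_big /= big_distrl /=; apply: ler_sum => k _.
rewrite -big_distrr /= ler_wpM2l// (bigD1 k)//= lerDl.
by apply: sumr_ge0 => k' _; apply: sumr_ge0.
Qed.

Lemma mxsum_eq0 m n (A : 'M[R]_(m, n)) : mxsum A <= 0 -> A = 0.
Proof.
move=> A0; apply/matrixP => i j; rewrite mxE; apply/eqP.
by rewrite -normr_le0 (le_trans (mxsum_entry A i j)).
Qed.

Lemma mxsum_le m n (A : 'M[R]_(m, n)) (e : R) : (forall i j, `|A i j| <= e) ->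
  mxsum A <= m%:R * n%:R * e.
Proof.
move=> Ae; apply: (@le_trans _ _ (\sum_(i < m) \sum_(j < n) e)).
  by apply: ler_sum => i _; exact: ler_sum.
by rewrite !sumr_const !card_ord -[leLHS]mulr_natl -[e *+ n]mulr_natl mulrA.
Qed.

Lemma bform_mxsum n (A : 'M[R]_n) (x y : 'rV[R]_n) : `|bform A x y| <= mxsum x * mxsum A * mxsum y.
Proof.
rewrite /bform (le_trans (mxsum_entry _ ord0 ord0))// (le_trans (mxsumM _ _))//.
have -> : mxsum y^T = mxsum y.
  rewrite /mxsum exchange_big /=; apply: eq_bigr => i _; apply: eq_bigr => j _.
  by rewrite mxE.
by rewrite ler_wpM2r ?mxsum_ge0// mxsumM.
Qed.

(** By the resolvent identity for the two inverses, and for the kernel of [B] by its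
    analogue [X = - (X *m D *m invmx A)] when [X *m (A + D) = 0]. *)
Lemma invmx_continuous n (A : 'M[R]_n) (e : R) : A \in unitmx -> 0 < e ->
  exists2 r : R, 0 < r & forall B : 'M[R]_n, mxsum (B - A) <= r ->
    B \in unitmx /\ mxsum (invmx B - invmx A) <= e.
Proof.
move=> uA e0; set a := mxsum (invmx A).
have a0 : 0 <= a by exact: mxsum_ge0.
pose r := Num.min (2 * (a + 1))^-1 (e / (2 * (a + 1) * (a + 1))).
have r0 : 0 < r by rewrite lt_min invr_gt0 divr_gt0 ?mulr_gt0//; lra.
have ra : r * (2 * (a + 1)) <= 1.
  by rewrite -ler_pdivlMr ?mul1r ?ge_min ?lexx//; lra.
have re : r * (2 * (a + 1) * (a + 1)) <= e.
  by rewrite -ler_pdivlMr ?ge_min ?lexx ?orbT// !mulr_gt0//; lra.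
exists r => // B Br; set D := B - A in Br.
have BE : B = A + D by rewrite /D addrC subrK.
have D0 := mxsum_ge0 D.
have Da : mxsum D * a <= 1 / 2 by nra.
have uB : B \in unitmx.
  rewrite -row_free_unit -kermx_eq0; apply/eqP/mxsum_eq0.
  set X := kermx B; have XB : X *m B = 0 by exact: mulmx_ker.
  have XE : X = - (X *m D *m invmx A).
    have : X *m A + X *m D = 0 by rewrite -mulmxDr -BE.
    move=> /eqP; rewrite addr_eq0 => /eqP h.
    by rewrite -[LHS](mulmxK uA) h mulNmx.
  have : mxsum X <= mxsum X * (mxsum D * a).
    rewrite {1}XE mxsumN (le_trans (mxsumM _ _))// mulrA ler_wpM2r// mxsumM//.
  have := mxsum_ge0 X; nra.
split=> //; set b := mxsum (invmx B).
have b0 : 0 <= b by exact: mxsum_ge0.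
have E : invmx B - invmx A = - (invmx B *m D *m invmx A).
  by rewrite /D mulmxBr mulVmx// mulmxBl mul1mx -mulmxA mulmxV// mulmx1 opprB.
have close : mxsum (invmx B - invmx A) <= b * mxsum D * a.
  by rewrite E mxsumN (le_trans (mxsumM _ _))// ler_wpM2r// mxsumM.
have bE : b <= 2 * a.
  have : b <= mxsum (invmx B - invmx A) + a.
    by rewrite /b -{1}[invmx B](subrK (invmx A)); exact: mxsumD.
  by nra.
have h1 : b * mxsum D * a <= 2 * a * r * a by rewrite ler_wpM2r// ler_pM.
have h2 : 0 <= r * (4 * a + 2) by rewrite mulr_ge0 ?(ltW r0)//; lra.
by rewrite (le_trans close)// (le_trans h1)//; lra.
Qed.

End inverse_perturbation.

(** * The statistic as a studentized mean *)

Lemma low_neq m (a : 'I_m) : low a != ord_max.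
Proof. by apply/eqP => /(congr1 val)/= h; have := ltn_ord a; rewrite h ltnn. Qed.

Section studentized_form.
Context {R : realType} {m q : nat}.
Notation N := (\sum_(s < q) m)%N.
Implicit Types (gam g : 'I_q -> 'I_m.+1 -> 'cV[R]_m.+1) (y : 'I_q -> 'cV[R]_m.+1).

(** What one observation contributes to the statistic, in first order the displacement of
    the top eigenvectors: the eigenvalue differences are left out. *)
Definition score gam y : 'rV[R]_N :=
  \mxrow_(s < q) \row_(a < m) (dotv (gam s ord_max) (y s) * dotv (gam s (low a)) (y s)).

(** The scores with the top sample eigenvector for the population one; the low eigenvectors
    are projected on its orthogonal complement, which the low sample ones span. *)
Definition sample_score gam g y : 'rV[R]_N :=
  \mxrow_(s < q) \row_(a < m)
    (dotv (g s ord_max) (y s) *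
     (dotv (gam s (low a)) (y s) -
      dotv (g s ord_max) (y s) * dotv (g s ord_max) (gam s (low a)))).

Definition gram n (w : nat -> 'rV[R]_N) : 'M[R]_N :=
  n%:R^-1 *: \sum_(r < n) (w r)^T *m w r.

Lemma mxrowE (r : forall s : 'I_q, 'rV[R]_m) j :
  (\mxrow_s r s) ord0 j = r (tagnat.sig1 j) ord0 (tagnat.sig2 j).
Proof. by rewrite mxE. Qed.

Lemma gramE n w i j :
  gram n w i j = n%:R^-1 * \sum_(r < n) w r ord0 i * w r ord0 j.
Proof.
rewrite /gram mxE summxE; congr (_ * _); apply: eq_bigr => r _.
by rewrite mxE big_ord1 mxE.
Qed.

Lemma gram_mulmx n w (F : 'M[R]_N) : gram n (fun r => w r *m F) = F^T *m gram n w *m F.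
Proof.
rewrite /gram -scalemxAr -scalemxAl mulmx_sumr mulmx_suml; congr (_ *: _).
by apply: eq_bigr => r _; rewrite trmx_mul !mulmxA.
Qed.

Lemma sum_low (F : 'I_m.+1 -> R) : \sum_(a < m) F (low a) = \sum_a F a - F ord_max.
Proof. by rewrite big_ord_recr /= addrK. Qed.

(** A form and its inverse matrix transform contragrediently; [F] is invertible because
    the transformed matrix is. *)
Lemma qform_congr n (F G : 'M[R]_n) (v z : 'rV[R]_n) : F^T *m G *m F \in unitmx ->
  v *m F = - z -> qform (invmx G) v = qform (invmx (F^T *m G *m F)) z.
Proof.
move=> uK vF; have := uK; rewrite !unitmx_mul unitmx_tr => /andP[/andP[_ uG] uF].
have -> : v = - z *m invmx F by rewrite -vF mulmxK.
have -> : invmx (F^T *m G *m F) = invmx F *m invmx G *m (invmx F)^T.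
  have : invmx F *m invmx G *m (invmx F)^T *m (F^T *m G *m F) = 1%:M.
    rewrite -!mulmxA (mulmxA (invmx F)^T) -trmx_mul mulmxV// trmx1 mul1mx.
    by rewrite (mulmxA (invmx G)) mulVmx// mul1mx mulVmx.
  by move=> h; rewrite -[LHS]mul1mx -h mulmxK.
by rewrite /bform trmx_mul !mulNmx [(- z)^T]raddfN/= !mulmxN opprK !mulmxA.
Qed.

Section change_of_frame.
Variables (n : nat) (x : nat -> 'I_q -> 'cV[R]_m.+1).
Variables (d : 'I_q -> 'I_m.+1 -> R) (g gam : 'I_q -> 'I_m.+1 -> 'cV[R]_m.+1).
Hypothesis dg : forall s, eigensystem (sample_moment n x s) (d s) (g s).
Hypothesis gam_orth : forall s a b, dotv (gam s a) (gam s b) = (a == b)%:R.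
Hypothesis d_simple : forall s (a : 'I_m), d s ord_max - d s (low a) != 0.

(** Both ends of the form contain [d_s(m+1) - d_s(a)] and the unknown rotation of the
    low sample eigenvectors; multiplying by [frame] removes both. *)
Let frame : 'M[R]_N := \mxdiag_(s < q) \matrix_(a < m, b < m)
  ((d s ord_max - d s (low a)) * dotv (g s (low a)) (gam s (low b))).

Let w r : 'rV[R]_N := \mxrow_(s < q) \row_(a < m)
  ((d s ord_max - d s (low a))^-1 * (dotv (g s (low a)) (x r s) * dotv (g s ord_max) (x r s))).

Lemma Gmatrix_gram : Gmatrix n x d g = gram n w.
Proof.
apply/matrixP => i j; rewrite gramE /Gmatrix mxE mxE -!mulrA; congr (_ * _).
rewrite !mulrA big_distrr /=; apply: eq_bigr => r _.
by rewrite !mxrowE !mxE; ring.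
Qed.

(** Parseval's identity for the sample eigenvectors, less the term of the top one. *)
Lemma gram_frame r : w r *m frame = sample_score gam g (x r).
Proof.
rewrite mul_mxrow_mxdiag; apply: eq_mxrow => s; apply/rowP => b; rewrite !mxE.
under eq_bigr => a _.
  rewrite !mxE [X in X * _]mulrC -mulrA [X in _ * X]mulrA mulVf// mul1r.
  rewrite (mulrC (dotv _ _)) -mulrA.
  over.
rewrite -big_distrr /= (sum_low (fun a => dotv (g s a) (x r s) * dotv (g s a) (gam s (low b)))).
by rewrite -(parseval (dg s)) (dotvC (x r s)).
Qed.

(** The sum over low [a] of [(gam s . g_a) (d_max - d_a) (g_a . gam s b)] extends to the top
    index, whose term is 0, and is then the form of [d_max - J] at two orthogonal
    vectors. *)
Lemma mean_frame :
  (\mxrow_(s < q) ((gam s ord_max)^T *m low_eigenvectors g s)) *m frame =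
  - (n%:R^-1 *: \sum_(r < n) score gam (x r)).
Proof.
rewrite mul_mxrow_mxdiag.
apply/rowP => j; rewrite mxrowE !mxE summxE.
set s := tagnat.sig1 j; set b := tagnat.sig2 j.
transitivity (- dotv (gam s ord_max) (sample_moment n x s *m gam s (low b))).
  rewrite (spectral_form (dg s)).
  transitivity (\sum_(a < m) (d s ord_max - d s (low a)) *
      (dotv (g s (low a)) (gam s ord_max) * dotv (g s (low a)) (gam s (low b)))).
    apply: eq_bigr => a _; rewrite !mxE.
    rewrite (_ : \sum_j0 _ = dotv (g s (low a)) (gam s ord_max)); first by ring.
    by rewrite dotvE; apply: eq_bigr => i _; rewrite !mxE mulrC.
  rewrite (sum_low (fun a => (d s ord_max - d s a) *
      (dotv (g s a) (gam s ord_max) * dotv (g s a) (gam s (low b))))).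
  rewrite subrr mul0r subr0; under eq_bigr do rewrite mulrBl.
  rewrite sumrB -big_distrr /= -(parseval (dg s)) gam_orth.
  by rewrite eq_sym (negbTE (low_neq b)) mulr0 sub0r.
congr (- _); rewrite /sample_moment -scalemxAl dotvZr; congr (_ * _).
rewrite mulmx_suml dotv_sumr; apply: eq_bigr => r _; rewrite mxrowE mxE -/s -/b.
rewrite -mulmxA [(x r s)^T *m _](_ : _ = (dotv (gam s (low b)) (x r s))%:M).
  by rewrite mul_mx_scalar dotvZr mulrC.
by apply/matrixP => i k; rewrite !ord1 [RHS]mxE mulr1n dotvC.
Qed.

Lemma T2_qform : gram n (fun r => sample_score gam g (x r)) \in unitmx ->
  T2 n x d g (fun s => gam s ord_max) =
  n%:R * qform (invmx (gram n (fun r => sample_score gam g (x r))))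
               (n%:R^-1 *: \sum_(r < n) score gam (x r)).
Proof.
have E : gram n (fun r => sample_score gam g (x r)) = frame^T *m Gmatrix n x d g *m frame.
  rewrite Gmatrix_gram -gram_mulmx; congr gram; apply/funext => r.
  by rewrite gram_frame.
rewrite E => uK; rewrite /T2 -(qform_congr uK mean_frame).
by [].
Qed.

End change_of_frame.

Lemma score_entry_le1 gam y i : (forall s a b, dotv (gam s a) (gam s b) = (a == b)%:R) ->
  (forall s, dotv (y s) (y s) = 1) -> `|score gam y ord0 i| <= 1.
Proof.
move=> go y1; rewrite mxrowE mxE normrM mulr_ile1//;
  by apply: dotv_unit_le1 => //; rewrite go eqxx.
Qed.

Lemma sample_score_close gam g y i (rho : R) :
  (forall s a b, dotv (gam s a) (gam s b) = (a == b)%:R) ->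
  (forall s, dotv (g s ord_max) (g s ord_max) = 1) ->
  (forall s, dotv (y s) (y s) = 1) -> 0 <= rho ->
  (forall s, dotv (g s ord_max - gam s ord_max) (g s ord_max - gam s ord_max) <= rho ^+ 2) ->
  `|sample_score gam g y ord0 i - score gam y ord0 i| <= 2 * rho.
Proof.
move=> go g1 y1 rho0 close; rewrite !mxrowE !mxE.
set s := tagnat.sig1 i; set a := tagnat.sig2 i.
have ga1 : dotv (gam s (low a)) (gam s (low a)) = 1 by rewrite go eqxx.
have small u : dotv u u = 1 -> `|dotv (g s ord_max - gam s ord_max) u| <= rho.
  move=> u1; rewrite -(@ler_pXn2r _ 2)// ?nnegrE// real_normK ?num_real//.
  by rewrite (le_trans (dotv_sqr_le _ _))// u1 mulr1.
have h1 := small _ (y1 s); have h2 := small _ ga1.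
have ort : dotv (gam s ord_max) (gam s (low a)) = 0.
  by rewrite go eq_sym (negbTE (low_neq a)).
have k1 := dotv_unit_le1 ga1 (y1 s); have k2 := dotv_unit_le1 (g1 s) (y1 s).
rewrite !dotvBl ort subr0 in h1 h2.
move: h1 h2 k1 k2; set u := dotv (g s ord_max) (y s); set v := dotv (gam s ord_max) (y s).
set t := dotv (gam s (low a)) (y s); set o := dotv (g s ord_max) (gam s (low a)).
move=> h1 h2 k1 k2.
have -> : u * (t - u * o) - v * t = (u - v) * t - u * u * o by ring.
rewrite (le_trans (ler_normB _ _))// !normrM (_ : 2 * rho = rho * 1 + 1 * 1 * rho); last by ring.
by rewrite lerD// !ler_pM.
Qed.

Lemma gram_close n (w w' : nat -> 'rV[R]_N) (e : R) : (0 < n)%N -> 0 <= e <= 1 ->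
  (forall r i, `|w r ord0 i| <= 1) ->
  (forall r i, `|w' r ord0 i - w r ord0 i| <= 2 * e) ->
  mxsum (gram n w' - gram n w) <= N%:R * N%:R * (8 * e).
Proof.
move=> n0 /andP[e0 e1] w1 ww'; apply: mxsum_le => i j.
have nR : 0 < n%:R :> R by rewrite ltr0n.
rewrite mxE [X in _ + X]mxE !gramE -mulrBr -sumrB normrM ger0_norm ?invr_ge0//.
rewrite mulrC ler_pdivrMr// mulrC.
have -> : n%:R * (8 * e) = \sum_(r < n) 8 * e by rewrite sumr_const card_ord mulr_natl.
rewrite (le_trans (ler_norm_sum _ _ _))//; apply: ler_sum => r _.
have a1 := w1 r i; have b1 := ww' r i; have b2 := ww' r j.
set x := w r ord0 i in a1 b1 *; set x' := w' r ord0 i in b1 *.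
set y := w r ord0 j in b2 *; set y' := w' r ord0 j in b2 *.
have a2 : `|y'| <= 3.
  by have := w1 r j; have := ler_normD (y' - y) y; rewrite subrK -/y; lra.
have -> : x' * y' - x * y = (x' - x) * y' + x * (y' - y) by ring.
rewrite (le_trans (ler_normD _ _))// !normrM (_ : 8 * e = 2 * e * 3 + 1 * (2 * e)); last by ring.
by rewrite lerD// ler_pM.
Qed.

End studentized_form.

(** * Convergence in probability *)

Section convergence_in_probability.
Context d (Omega : measurableType d) (R : realType) (P : probability Omega R).

Lemma prob_le_sub (A B : set Omega) : measurable A -> measurable B -> A `<=` B ->
  fine (P A) <= fine (P B).
Proof.
move=> mA mB AB; apply: fine_le; rewrite ?fin_num_measure//.
by apply: le_measure; rewrite ?inE.
Qed.

Lemma prob_setU_le (A B : set Omega) : measurable A -> measurable B ->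
  fine (P (A `|` B)) <= fine (P A) + fine (P B).
Proof.
move=> mA mB; rewrite -fineD ?fin_num_measure//; apply: fine_le.
- by rewrite fin_num_measure//; exact: measurableU.
- by rewrite fin_numD !fin_num_measure.
exact: measureU2.
Qed.

Lemma measurable_exists (I : finType) (A : I -> set Omega) :
  (forall i, measurable (A i)) -> measurable [set w | exists i, A i w].
Proof.
move=> mA; rewrite (_ : [set w | _] = \bigcup_(i in setT) A i).
  by apply: fin_bigcup_measurable => //; exact: finite_finset.
by apply/seteqP; split => [w [i Aiw]|w [i _ Aiw]]; exists i.
Qed.

Lemma prob_exists_le (I : finType) (A : I -> set Omega) :
  (forall i, measurable (A i)) ->
  fine (P [set w | exists i, A i w]) <= \sum_i fine (P (A i)).
Proof.
move=> mA; have mE := measurable_exists mA.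
rewrite -mean_indic//; under eq_bigr do rewrite -mean_indic//.
have bI i := bounded_measurable_indic (R := R) (mA i).
rewrite -mean_sum//; apply: le_mean.
- exact: bounded_measurable_indic.
- exact: bounded_measurable_sum.
move=> w; rewrite [leLHS]indicE; case: (boolP (w \in _)) => [|_]; last by apply: sumr_ge0.
rewrite inE /= => -[i Ai]; rewrite (bigD1 i)//= indicE mem_set// lerDl.
by apply: sumr_ge0.
Qed.

(** By uniform continuity of [f] on a segment which [Z n] leaves with small probability. *)
Lemma slutsky (X Z : nat -> Omega -> R) (f : R -> R) (B l : R) :
  (forall n, measurable_fun setT (X n)) -> (forall n, measurable_fun setT (Z n)) ->
  (forall e, 0 < e -> (fun n => fine (P [set w | e <= `|X n w - Z n w|])) @ \oo --> 0) ->
  (forall e, 0 < e -> exists K, \forall n \near \oo, fine (P [set w | K <= `|Z n w|]) <= e) ->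
  continuous f -> (forall x, `|f x| <= B) ->
  (fun n => \int[P]_w f (Z n w)) @ \oo --> l -> (fun n => \int[P]_w f (X n w)) @ \oo --> l.
Proof.
move=> mX mZ XZ tight cf fB Zl.
have B0 : 0 <= B by apply: le_trans (fB 0).
have mf : measurable_fun setT f by exact: continuous_measurable_fun.
have bX n : bounded_measurable (fun w => f (X n w)).
  by apply: (bounded_measurable_comp mf (mX n)) => w; exact: fB.
have bZ n : bounded_measurable (fun w => f (Z n w)).
  by apply: (bounded_measurable_comp mf (mZ n)) => w; exact: fB.
apply/cvgrPdist_le => e e0.
pose a := e / (2 + 4 * B).
have dB : 0 < 2 + 4 * B by lra.
have a0 : 0 < a by rewrite divr_gt0.
have ae : (2 + 4 * B) * a = e by rewrite /a mulrC divfK// gt_eqF.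
have [K hK] := tight a a0.
have [r r0 hr] := continuous_segment_unif (- K) K cf a0.
have /cvgrPdist_le/(_ a a0) hXZ := XZ r r0.
move/cvgrPdist_le : Zl => /(_ a a0) hl.
near=> n.
pose C1 := [set w | K <= `|Z n w|]; pose C2 := [set w | r <= `|X n w - Z n w|].
have mC1 : measurable C1.
  rewrite -[X in measurable X]setTI.
  by apply: measurable_fun_le => //; exact: measurableT_comp.
have mC2 : measurable C2.
  rewrite -[X in measurable X]setTI; apply: measurable_fun_le => //.
  by apply: measurableT_comp => //; exact: measurable_funB.
have h1 : fine (P C1) <= a by rewrite /C1; near: n.
have h2 : fine (P C2) <= a.
  have : `|0 - fine (P C2)| <= a by rewrite /C2; near: n.
  by rewrite sub0r normrN; apply: le_trans; exact: ler_norm.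
have h3 : `|l - \int[P]_w f (Z n w)| <= a by near: n.
have bi1 := bounded_measurable_indic (R := R) mC1.
have bi2 := bounded_measurable_indic (R := R) mC2.
have bc (c : R) : bounded_measurable (fun _ : Omega => c) := bounded_measurable_cst c.
have b12 := bounded_measurableM (bc (2 * B)) (bounded_measurableD bi1 bi2).
have h4 : `|\int[P]_w f (Z n w) - \int[P]_w f (X n w)| <=
    a + 2 * B * (fine (P C1) + fine (P C2)).
  have bZX := bounded_measurableB (bZ n) (bX n).
  rewrite -meanB// (le_trans (le_normr_Rintegral _ _))//.
    exact: bounded_measurable_integrable.
  rewrite -!mean_indic// -meanD// -meanZ; last exact: bounded_measurableD.
  rewrite -[X in X + _](mean_cst P) -(meanD P (bc a) b12).
  apply: le_mean; [exact: bounded_measurable_norm|exact: bounded_measurableD|].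
  move=> w; rewrite !indicE.
  have fbig : `|f (Z n w) - f (X n w)| <= 2 * B.
    rewrite (le_trans (ler_normB _ _))//.
    by have := fB (Z n w); have := fB (X n w); lra.
  case: (boolP (w \in C1)) => [_|].
    case: (w \in C2) => /=; first by lra.
    by lra.
  rewrite notin_setE /C1 /= => /negP; rewrite -ltNge => ZK.
  case: (boolP (w \in C2)) => [_|].
    by rewrite /=; lra.
  rewrite notin_setE /C2 /= => /negP; rewrite -ltNge => XZr.
  rewrite addr0 mulr0 addr0; apply/ltW/hr; last by rewrite distrC.
  by move: ZK; rewrite ltr_norml => /andP[/ltW -> /ltW ->].
rewrite (le_trans (ler_distD (\int[P]_w f (Z n w)) _ _))//.
have h5 : 2 * B * (fine (P C1) + fine (P C2)) <= 2 * B * (a + a).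
  by rewrite ler_wpM2l ?mulr_ge0// lerD.
by lra.
Unshelve. all: by end_near.
Qed.

End convergence_in_probability.

Section partial_sum_tight.
Context d (Omega : measurableType d) (R : realType) (P : probability Omega R).
Context d' (S : measurableType d') (Q : probability S R) (Y : nat -> {RV P >-> S}).
Hypothesis Y_indep : mutually_independent Y.
Hypothesis Y_law : forall r (A : set S), measurable A -> distribution P (Y r) A = Q A.
Variables (N : nat) (z : S -> 'rV[R]_N).
Hypothesis z_meas : forall i, measurable_fun setT (fun y => z y ord0 i).
Hypothesis z_le1 : forall y i, `|z y ord0 i| <= 1.
Hypothesis z_mean0 : forall i, \int[Q]_y z y ord0 i = 0.

Let z_bounded i : bounded_measurable (fun y => z y ord0 i).
Proof. by split=> //; exists 1. Qed.

Definition large_sum n (L : R) : set Omega :=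
  [set w | exists i, L * Num.sqrt n%:R <= `|partial_sum Y z n w ord0 i|].

Lemma partial_sum_measurable n i : measurable_fun setT (fun w => partial_sum Y z n w ord0 i).
Proof.
rewrite /partial_sum; under eq_fun do rewrite summxE.
by apply: measurable_sum => r; exact: (measurableT_comp (z_meas i)).
Qed.

Lemma measurable_large_sum n L : measurable (large_sum n L).
Proof.
apply: measurable_exists => i; rewrite -[X in measurable X]setTI.
apply: measurable_fun_le => //; apply: measurableT_comp => //.
exact: partial_sum_measurable.
Qed.

(** Chebyshev's inequality for each coordinate, whose variance is at most [n]. *)
Lemma prob_large_sum n (L : R) : (0 < n)%N -> 0 < L ->
  fine (P (large_sum n L)) <= N%:R / L ^+ 2.
Proof.
move=> n0 L0; have nR : 0 < n%:R :> R by rewrite ltr0n.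
have sn0 : 0 < Num.sqrt (n%:R : R) by rewrite sqrtr_gt0.
have bs i : bounded_measurable (fun w => partial_sum Y z n w ord0 i).
  rewrite /partial_sum; under eq_fun do rewrite summxE.
  by apply: bounded_measurable_sum => r; exact: (bounded_measurable_now Y r (z_bounded i)).
apply: (le_trans (prob_exists_le _ _)).
  move=> i; rewrite -[X in measurable X]setTI.
  apply: measurable_fun_le => //; apply: measurableT_comp => //.
  exact: partial_sum_measurable.
apply: (@le_trans _ _ (\sum_(i < N) L ^- 2)); last first.
  by rewrite sumr_const card_ord -[leLHS]mulr_natl.
apply: ler_sum => i _; apply: (le_trans (prob_ge_le_mean_sqr P (bs i) _)).
  exact: mulr_gt0.
have -> : \int[P]_w (partial_sum Y z n w ord0 i ^+ 2) = n%:R * \int[Q]_y (z y ord0 i ^+ 2).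
  rewrite -(mean_sqr_sum Y_indep Y_law n (z_bounded i) (z_mean0 i)).
  by apply: eq_Rintegral => w _; rewrite /partial_sum summxE.
have sq1 : \int[Q]_y (z y ord0 i ^+ 2) <= 1.
  rewrite -[leRHS](mean_cst Q) le_mean//; first exact: bounded_measurableM.
    exact: bounded_measurable_cst.
  by move=> y; rewrite -real_normK ?num_real// exprn_ile1.
set v := \int[Q]_y _ in sq1 *.
have -> : (L * Num.sqrt n%:R) ^- 2 * (n%:R * v) = L ^- 2 * v.
  by rewrite exprMn sqr_sqrtr ?ler0n//; field; rewrite !gt_eqF.
by rewrite ler_piMr// invr_ge0 exprn_ge0// ltW.
Qed.

End partial_sum_tight.

(** * Scores of samples of axes *)

Section projective_scores.
Context {R : realType} {m q : nat}.
Notation N := (\sum_(s < q) m)%N.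

Lemma rp_embed_axis (p : projective_space R m) (x : 'cV[R]_m.+1) :
  val p = axis x -> rp_embed p = x *m x^T.
Proof.
rewrite /rp_embed => ->.
have : axis x (xget 0 (axis x)) by apply: (@xgetI _ 0 _ x); left.
by case=> [->//|->]; rewrite raddfN/= mulNmx mulmxN opprK.
Qed.

Lemma rp_embed_entry_le1 (p : projective_space R m) i j : `|rp_embed p i j| <= 1.
Proof.
have : (val p) \in @axis R m @` @unit_sphere R m by exact: valP.
rewrite inE => -[x x1 /esym/rp_embed_axis ->].
rewrite !mxE big_ord1 mxE normrM.
have entry k : `|x k ord0| <= 1.
  rewrite -(@expr_le1 _ 2)// real_normK ?num_real//.
  have <- : dotv x x = 1 by [].
  rewrite dotvE (bigD1 k)//= -expr2 lerDl sumr_ge0// => l _.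
  by rewrite -expr2 sqr_ge0.
by rewrite mulr_ile1.
Qed.

Lemma measurable_rp_embed i j : measurable_fun [set: RP R m] (fun p => rp_embed p i j).
Proof.
apply: (measurability _ (RGenOpens.measurableE R)).
move=> _ [_ [a [b ->]] <-]; rewrite setTI; apply: sub_sigma_algebra.
exists ((fun M : 'M[R]_m.+1 => M i j) @^-1` `]a, b[) => //=.
by apply: open_comp => [M _|]; [exact: coord_continuous|exact: interval_open].
Qed.

Definition axis_entry (s : 'I_q) i j (p : q.-tuple (RP R m)) : R := rp_embed (tnth p s) i j.

Lemma axis_entry_bounded s i j : bounded_measurable (axis_entry s i j).
Proof.
split; last by exists 1 => p; exact: rp_embed_entry_le1.
by apply: (measurableT_comp (measurable_rp_embed i j)); exact: measurable_tnth.
Qed.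

(** The score is even in each unit vector, so it is a function of the axes, and as such a
    measurable function of the observations. *)
Definition axis_score (gam : 'I_q -> 'I_m.+1 -> 'cV[R]_m.+1) (p : q.-tuple (RP R m)) :
    'rV[R]_N :=
  \mxrow_(s < q) \row_(a < m)
    (\sum_i \sum_j gam s ord_max i ord0 * gam s (low a) j ord0 * axis_entry s i j p).

Lemma axis_scoreE gam p (y : 'I_q -> 'cV[R]_m.+1) :
  (forall s, val (tnth p s) = axis (y s)) -> axis_score gam p = score gam y.
Proof.
move=> py; apply: eq_mxrow => s; apply/rowP => a; rewrite !mxE.
rewrite [RHS]mulrC !dotvE big_distrr /= [LHS](_ : _ = \sum_i \sum_j
  (gam s (low a) j ord0 * y s j ord0) * (gam s ord_max i ord0 * y s i ord0)).
  by apply: eq_bigr => i _; rewrite big_distrl.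
apply: eq_bigr => i _; apply: eq_bigr => j _.
by rewrite /axis_entry (rp_embed_axis (py s)) mxE big_ord1 mxE; ring.
Qed.

Lemma axis_score_bounded gam i : bounded_measurable (fun p => axis_score gam p ord0 i).
Proof.
under eq_fun do rewrite mxrowE mxE.
do 2 apply: bounded_measurable_sum => ?.
by apply: bounded_measurableM; [exact: bounded_measurable_cst|exact: axis_entry_bounded].
Qed.

End projective_scores.

(** * The chi-square limit *)

Section extrinsic_statistic.
Context (R : realType) (m q : nat).
Notation N := (\sum_(s < q) m)%N.
Context (disp : measure_display) (Omega : measurableType disp) (P : probability Omega R).
Variables (Q : probability (q.-tuple (RP R m)) R)
  (Y : nat -> {RV P >-> q.-tuple (RP R m)}).
Hypothesis Y_law : forall (r : nat) (A : set (q.-tuple (RP R m))), measurable A ->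
     distribution P (Y r) A = Q A.
Hypothesis Y_indep : mutually_independent Y.
Variable X : nat -> 'I_q -> Omega -> 'cV[R]_m.+1.
Hypothesis X_unit : forall r s w, dotv (X r s w) (X r s w) = 1.
Hypothesis X_axis : forall r s w, val (tnth (Y r w) s) = axis (X r s w).
Variables (lam : 'I_q -> 'I_m.+1 -> R) (gam : 'I_q -> 'I_m.+1 -> 'cV[R]_m.+1).
Hypothesis lam_gam : forall s, eigensystem (second_moment P (X 0%N s)) (lam s) (gam s).
Hypothesis lam_simple : forall s a, a != ord_max -> lam s a != lam s ord_max.
Hypothesis cov_nonsingular : extrinsic_cov P (X 0%N) lam gam \in unitmx.

Let z := axis_score gam.

Lemma score_sample r w : z (Y r w) = score gam (fun s => X r s w).
Proof. by apply: axis_scoreE => s; exact: X_axis. Qed.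

Lemma axis_entry_sample r w s i j : axis_entry s i j (Y r w) = X r s w i ord0 * X r s w j ord0.
Proof. by rewrite /axis_entry (rp_embed_axis (X_axis r s w)) mxE big_ord1 mxE. Qed.

Lemma gam_orth s a b : dotv (gam s a) (gam s b) = (a == b)%:R.
Proof. by have [_ -> _] := lam_gam s. Qed.

Lemma second_momentE s i j :
  second_moment P (X 0%N s) i j = \int[Q]_p axis_entry s i j p.
Proof.
rewrite mxE unlock -(mean_law Y_law 0 (axis_entry_bounded s i j)).
by apply: eq_Rintegral => w _; rewrite axis_entry_sample.
Qed.

Definition score_cov : 'M[R]_N := \matrix_(i, j) \int[Q]_p (z p ord0 i * z p ord0 j).

(** The mean is the value of the form of the second moment at two different eigenvectors. *)
Lemma score_mean0 i : \int[Q]_p z p ord0 i = 0.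
Proof.
set s := tagnat.sig1 i; set a := tagnat.sig2 i.
have bE k l : bounded_measurable (fun p => gam s ord_max k ord0 * gam s (low a) l ord0 *
    axis_entry s k l p).
  by apply: bounded_measurableM; [exact: bounded_measurable_cst|exact: axis_entry_bounded].
under eq_Rintegral do rewrite /z /axis_score mxrowE mxE.
rewrite mean_sum; last by move=> k; apply: bounded_measurable_sum.
transitivity (dotv (gam s ord_max) (second_moment P (X 0%N s) *m gam s (low a))).
  rewrite dotvE; apply: eq_bigr => k _; rewrite mean_sum// mxE big_distrr /=.
  apply: eq_bigr => l _; rewrite meanZ ?second_momentE; last exact: axis_entry_bounded.
  by ring.
have [_ _ ->] := lam_gam s.
by rewrite dotvZr gam_orth eq_sym (negbTE (low_neq a)) mulr0.
Qed.

(** The extrinsic covariance is [score_cov] between two diagonal matrices. *)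
Lemma score_cov_unit : score_cov \in unitmx.
Proof.
pose D : 'M[R]_N := diag_mx (\row_i
  (lam (tagnat.sig1 i) ord_max - lam (tagnat.sig1 i) (low (tagnat.sig2 i)))^-1).
suff E : extrinsic_cov P (X 0%N) lam gam = D *m score_cov *m D.
  by move: cov_nonsingular; rewrite E !unitmx_mul => /andP[/andP[]].
apply/matrixP => i j; rewrite mul_mx_diag mul_diag_mx !mxE unlock.
set c := \int[Q]_p _.
have <- : \int[P]_w (z (Y 0%N w) ord0 i * z (Y 0%N w) ord0 j) = c.
  rewrite (mean_law Y_law 0 (f := fun p => z p ord0 i * z p ord0 j))//.
  by apply: bounded_measurableM; exact: axis_score_bounded.
rewrite [RHS]mulrAC; congr (_ * _); apply: eq_Rintegral => w _.
by rewrite !score_sample /score !mxrowE !mxE; ring.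
Qed.

Lemma spectral_gap : exists2 gap : R, 0 < gap &
  forall s a, a != ord_max -> lam s a + gap <= lam s ord_max.
Proof.
exists (\big[Num.min/1]_(p : 'I_q * 'I_m.+1 | p.2 != ord_max)
    (lam p.1 ord_max - lam p.1 p.2)).
  apply: (big_ind (fun v : R => 0 < v)) => // [x y x0 y0|[s a] /= aN]; first by rewrite lt_min x0.
  have [mono _ _] := lam_gam s.
  by rewrite subr_gt0 lt_neqAle lam_simple//= mono// -ltnS ltn_ord.
move=> s a aN; rewrite -lerBrDl.
exact: (bigmin_le_cond 1 (fun p : 'I_q * 'I_m.+1 => lam p.1 ord_max - lam p.1 p.2)
  (j := (s, a)) aN).
Qed.

Variables (d : nat -> Omega -> 'I_q -> 'I_m.+1 -> R)
  (g : nat -> Omega -> 'I_q -> 'I_m.+1 -> 'cV[R]_m.+1).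
Hypothesis d_g : forall n w s,
  eigensystem (sample_moment n (fun r t => X r t w) s) (d n w s) (g n w s).
Hypothesis g_oriented : forall n w s, 0 <= dotv (gam s ord_max) (g n w s ord_max).

Let T n w := T2 n (fun r t => X r t w) (d n w) (g n w) (fun s => gam s ord_max).

(** The statistic that could be computed if [gam] and the covariance of the score were
    known. *)
Definition oracle n w : R := n%:R^-1 * qform (invmx score_cov) (partial_sum Y z n w).

(** On a sample whose second moments are close to the population ones, the sample
    eigenvectors [g n w s ord_max] are close to the population ones, hence the transform
    of [G] by the change of frame is close to [score_cov]. *)
Lemma statistic_close_of_moments (L e : R) : 0 < L -> 0 < e -> exists2 a : R, 0 < a &
  forall n w, (0 < n)%N ->
  (forall s i j, `|n%:R^-1 * (\sum_(r < n) axis_entry s i j (Y r w)) -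
     \int[Q]_p axis_entry s i j p| < a) ->
  (forall i j, `|n%:R^-1 * (\sum_(r < n) z (Y r w) ord0 i * z (Y r w) ord0 j) -
     \int[Q]_p (z p ord0 i * z p ord0 j)| < a) ->
  (forall i, `|partial_sum Y z n w ord0 i| < L * Num.sqrt n%:R) ->
  `|T n w - oracle n w| < e.
Proof.
move=> L0 e0.
pose NR : R := N%:R.
have NR0 : 0 <= NR by exact: ler0n.
(* [(NR * L) ^+ 2 * n] bounds the squared norm of the partial sum. *)
pose e' := e / ((NR * L) ^+ 2 + 1).
have NL0 : 0 < (NR * L) ^+ 2 + 1 by rewrite ltr_wpDl// sqr_ge0.
have e'0 : 0 < e' by rewrite divr_gt0.
have [r r0 hr] := invmx_continuous score_cov_unit e'0.
have [gap gap0 hgap] := spectral_gap.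
have NN0 : 0 < NR * NR + 1 by rewrite ltr_wpDl// mulr_ge0.
(* [rho] bounds the distance of the top eigenvectors; it costs [8 * rho] per entry of the
   Gram matrix. *)
pose rho := Num.min 1 (r / (16 * (NR * NR + 1))).
have rho0 : 0 < rho by rewrite lt_min ltr01 divr_gt0// mulr_gt0.
have rho1 : rho <= 1 by rewrite ge_min lexx.
have rhor : NR * NR * (8 * rho) <= r / 2.
  have : rho * (16 * (NR * NR + 1)) <= r.
    by rewrite -ler_pdivlMr ?mulr_gt0// ge_min lexx orbT.
  by have := mulr_ge0 NR0 NR0; nra.
pose K : R := m.+1%:R ^+ 2.
have K0 : 0 < K by rewrite exprn_gt0.
(* Accuracy of the second moments which ensures [rho], and also that the largest sample
   eigenvalue is simple. *)
pose a1 := gap * rho ^+ 2 / (8 * K).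
have a10 : 0 < a1 by rewrite divr_gt0 ?mulr_gt0 ?exprn_gt0.
have Ka1 : 8 * (K * a1) = gap * rho ^+ 2 by rewrite /a1; field; rewrite gt_eqF.
(* Accuracy of the sample covariance of the exact scores. *)
pose a2 := r / (2 * (NR * NR + 1)).
have a20 : 0 < a2 by rewrite divr_gt0 ?mulr_gt0.
have a2r : NR * NR * a2 <= r / 2.
  have : a2 * (2 * (NR * NR + 1)) = r by rewrite /a2 divfK// gt_eqF// mulr_gt0.
  by lra.
exists (Num.min a1 a2); first by rewrite lt_min a10.
move=> n w n0 hJ hS hL.
have nR : 0 < n%:R :> R by rewrite ltr0n.
pose x k t := X k t w.
have AJ s i j : `|sample_moment n x s i j - second_moment P (X 0%N s) i j| <= a1.
  have := hJ s i j; rewrite lt_min => /andP[/ltW h _]; move: h.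
  rewrite second_momentE /sample_moment mxE summxE.
  by under [in X in _ -> X]eq_bigr do rewrite mxE big_ord1 mxE -axis_entry_sample.
have rho2 : rho ^+ 2 <= 1 by rewrite exprn_ile1// ltW.
have simple s (a : 'I_m) : d n w s ord_max - d n w s (low a) != 0.
  rewrite subr_eq0 eq_sym.
  apply: (sample_eigenvalue_simple (lam_gam s) (d_g n w s) gap0 (hgap s) (AJ s) _ (low_neq a)).
  by rewrite -/K; nra.
have close s : dotv (g n w s ord_max - gam s ord_max) (g n w s ord_max - gam s ord_max) <=
    rho ^+ 2.
  have := oriented_eigenvector_close (lam_gam s) (d_g n w s) gap0 (hgap s) (AJ s)
    (g_oriented n w s).
  rewrite -/K => h; have : 0 <= gap * rho ^+ 2 by rewrite mulr_ge0 ?sqr_ge0// ltW.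
  move=> h2; rewrite -(ler_pM2l gap0); lra.
have x1 k s : dotv (x k s) (x k s) = 1 by exact: X_unit.
have g1 s : dotv (g n w s ord_max) (g n w s ord_max) = 1 := eigenvector_norm (d_g n w s) ord_max.
pose G0 := gram n (fun k => score gam (x k)).
pose G1 := gram n (fun k => sample_score gam (g n w) (x k)).
have G10 : mxsum (G1 - G0) <= r / 2.
  apply: le_trans rhor; apply: gram_close => //; first by rewrite (ltW rho0).
    by move=> k i; apply: score_entry_le1 => //; exact: gam_orth.
  move=> k i; apply: sample_score_close => //; [exact: gam_orth|exact: ltW].
have G0S : mxsum (G0 - score_cov) <= r / 2.
  apply: le_trans a2r; apply: mxsum_le => i j.
  have := hS i j; rewrite lt_min => /andP[_ /ltW h]; move: h.
  rewrite mxE [X in _ -> `|_ + X| <= _]mxE gramE [X in _ -> `|_ - X| <= _]mxE.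
  by under eq_bigr do rewrite !score_sample.
have [uG1 invG1] : G1 \in unitmx /\ mxsum (invmx G1 - invmx score_cov) <= e'.
  apply: hr; rewrite -[G1](subrK G0) -addrA (le_trans (mxsumD _ _))//.
  by move: G10 G0S; lra.
have psumE : \sum_(k < n) score gam (x k) = partial_sum Y z n w.
  by apply: eq_bigr => k _; rewrite score_sample.
have -> : T n w - oracle n w =
    n%:R^-1 * qform (invmx G1 - invmx score_cov) (partial_sum Y z n w).
  rewrite /T (T2_qform (d_g n w) gam_orth simple uG1) -/G1 psumE bformZl bformZr.
  by rewrite /oracle bformBm; field; rewrite gt_eqF.
have psum_le : mxsum (partial_sum Y z n w) <= NR * (L * Num.sqrt n%:R).
  have := @mxsum_le R _ _ (partial_sum Y z n w) (L * Num.sqrt n%:R).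
  by rewrite mul1r; apply => i j; rewrite ord1 ltW.
rewrite normrM ger0_norm ?invr_ge0// mulrC ltr_pdivrMr//.
apply: (@le_lt_trans _ _ ((NR * (L * Num.sqrt n%:R)) ^+ 2 * e')).
  rewrite (le_trans (bform_mxsum _ _ _))// mulrAC.
  apply: ler_pM; rewrite ?mulr_ge0 ?mxsum_ge0//.
  by rewrite expr2 ler_pM ?mxsum_ge0.
rewrite mulrA exprMn sqr_sqrtr ?ler0n// mulrAC ltr_pM2r//.
have : e' * ((NR * L) ^+ 2 + 1) = e by rewrite /e' divfK// gt_eqF.
by lra.
Qed.

Hypothesis mT : forall n, measurable_fun setT (T n).

Let z_bounded i : bounded_measurable (fun p => z p ord0 i) := axis_score_bounded gam i.

Let z_cov i j : \int[Q]_p (z p ord0 i * z p ord0 j) = score_cov i j.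
Proof. by rewrite mxE. Qed.

Let z_le1 p i : `|z p ord0 i| <= 1.
Proof.
have [y y1 py] : exists2 y : 'I_q -> 'cV[R]_m.+1, forall s, dotv (y s) (y s) = 1 &
    forall s, val (tnth p s) = axis (y s).
  have H s : exists y : 'cV[R]_m.+1, dotv y y = 1 /\ val (tnth p s) = axis y.
    have : (val (tnth p s)) \in @axis R m @` @unit_sphere R m by exact: valP.
    by rewrite inE => -[y y1 /esym py]; exists y.
  exists (fun s => sval (cid (H s))) => s; by case: cid => y [].
rewrite /z (axis_scoreE _ py); apply: score_entry_le1 => //; exact: gam_orth.
Qed.

Lemma measurable_oracle n : measurable_fun setT (oracle n).
Proof.
apply: measurable_funM => //.
under eq_fun do rewrite bformE2.
apply: measurable_sum => i; apply: measurable_sum => j; apply: measurable_funM => //.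
by apply: measurable_funM; apply: partial_sum_measurable => k; have [] := z_bounded k.
Qed.

Lemma oracle_ge0 n w : 0 <= oracle n w.
Proof.
rewrite mulr_ge0 ?invr_ge0// qform_inv ?score_cov_unit//; last exact: (cov_sym z_cov).
exact: (cov_ge0 z_bounded z_cov).
Qed.

Lemma large_sum_rare (e : R) : 0 < e -> exists2 L : R, 0 < L &
  forall n, (0 < n)%N -> fine (P (large_sum Y z n L)) <= e.
Proof.
move=> e0; have N0 : 0 <= N%:R :> R by exact: ler0n.
have N1 : 0 < N%:R + 1 :> R by rewrite ltr_wpDl.
pose L := Num.sqrt ((N%:R + 1) / e).
have L2 : L ^+ 2 = (N%:R + 1) / e by rewrite sqr_sqrtr// ltW// divr_gt0.
have L0 : 0 < L by rewrite sqrtr_gt0 divr_gt0.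
exists L => // n n0.
have := prob_large_sum Y_indep Y_law (fun i => (z_bounded i).1) z_le1 score_mean0 n0 L0.
move=> /le_trans; apply; rewrite L2 invf_div mulrA ler_pdivrMr// mulrC.
by rewrite ler_pM2l//; lra.
Qed.

Lemma oracle_le n w (L : R) : (0 < n)%N -> ~ large_sum Y z n L w ->
  oracle n w <= (N%:R * L) ^+ 2 * mxsum (invmx score_cov).
Proof.
move=> n0 nL; have nR : 0 < n%:R :> R by rewrite ltr0n.
have hL i : `|partial_sum Y z n w ord0 i| <= L * Num.sqrt n%:R.
  by rewrite leNgt; apply/negP => /ltW h; apply: nL; exists i.
have psum_le : mxsum (partial_sum Y z n w) <= N%:R * (L * Num.sqrt n%:R).
  have := @mxsum_le R _ _ (partial_sum Y z n w) (L * Num.sqrt n%:R).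
  by rewrite mul1r; apply => i j; rewrite ord1.
rewrite /oracle mulrC ler_pdivrMr// (le_trans (ler_norm _))//.
rewrite (le_trans (bform_mxsum _ _ _))//.
have -> : (N%:R * L) ^+ 2 * mxsum (invmx score_cov) * n%:R =
    (N%:R * (L * Num.sqrt n%:R)) * mxsum (invmx score_cov) * (N%:R * (L * Num.sqrt n%:R)).
  by rewrite -[in LHS](@sqr_sqrtr R n%:R)//; ring.
by rewrite !ler_pM ?mulr_ge0 ?mxsum_ge0.
Qed.

Lemma oracle_tight (e : R) : 0 < e ->
  exists K, \forall n \near \oo, fine (P [set w | K <= `|oracle n w|]) <= e.
Proof.
move=> e0; have [L L0 hL] := large_sum_rare e0.
exists ((N%:R * L) ^+ 2 * mxsum (invmx score_cov) + 1).
near=> n; have n0 : (0 < n)%N by near: n; exact: nbhs_infty_gt.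
apply: le_trans (hL n n0); apply: prob_le_sub.
- rewrite -[X in measurable X]setTI; apply: measurable_fun_le => //.
  by apply: measurableT_comp => //; exact: measurable_oracle.
- by apply: measurable_large_sum => i; have [] := z_bounded i.
move=> w /= h; apply: contrapT => /(oracle_le n0).
by move: h; rewrite ger0_norm ?oracle_ge0//; lra.
Unshelve. all: by end_near.
Qed.

(** Outside an event of small probability, the sample moments are close to their means and
    the sum of the scores is of order [Num.sqrt n].  Off that event the bound holds
    pointwise, however the sample eigenvectors depend on the sample. *)
Lemma statistic_close_oracle (e : R) : 0 < e ->
  (fun n => fine (P [set w | e <= `|T n w - oracle n w|])) @ \oo --> 0.
Proof.
move=> e0; apply/cvgrPdist_le => c c0.
have c30 : 0 < c / 3 by rewrite divr_gt0.
have [L L0 hL] := large_sum_rare c30.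
have [a a0 good] := statistic_close_of_moments L0 e0.
pose f1 (u : 'I_q * 'I_m.+1 * 'I_m.+1) := @axis_entry R m q u.1.1 u.1.2 u.2.
pose f2 (u : 'I_N * 'I_N) p : R := z p ord0 u.1 * z p ord0 u.2.
have bf1 u : bounded_measurable (f1 u) by exact: axis_entry_bounded.
have bf2 u : bounded_measurable (f2 u) by exact: bounded_measurableM.
pose dev (f : q.-tuple (RP R m) -> R) n :=
  [set w | a <= `|n%:R^-1 * (\sum_(r < n) f (Y r w)) - \int[Q]_p f p|].
have mdev f n : bounded_measurable f -> measurable (dev f n).
  move=> bf; rewrite -[X in measurable X]setTI; apply: measurable_fun_le => //.
  apply: measurableT_comp => //; apply: measurable_funB => //.
  apply: measurable_funM => //; apply: measurable_sum => r.
  by apply: (measurableT_comp bf.1).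
have vanish (I : finType) (f : I -> q.-tuple (RP R m) -> R) :
    (forall u, bounded_measurable (f u)) ->
    \forall n \near \oo, fine (P [set w | exists u, dev (f u) n w]) <= c / 3.
  move=> bf.
  have : (fun n => \sum_u fine (P (dev (f u) n))) @ \oo --> (\sum_(u : I) 0 : R).
    apply: cvg_big => [|u _]; first exact: add_continuous.
    exact: (weak_law Y_indep Y_law (bf u) a0).
  rewrite big1// => /cvgrPdist_le/(_ _ c30); apply: filterS => n.
  rewrite sub0r normrN => h; apply: le_trans (prob_exists_le _ _) _.
    by move=> u; exact: mdev.
  exact: le_trans (ler_norm _) h.
have v1 := vanish _ f1 bf1; have v2 := vanish _ f2 bf2.
near=> n; have n0 : (0 < n)%N by near: n; exact: nbhs_infty_gt.
rewrite sub0r normrN ger0_norm ?fine_ge0//.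
pose E1 := [set w | exists u, dev (f1 u) n w].
pose E2 := [set w | exists u, dev (f2 u) n w].
have mE1 : measurable E1 by apply: measurable_exists => u; exact: mdev.
have mE2 : measurable E2 by apply: measurable_exists => u; exact: mdev.
have mE3 : measurable (large_sum Y z n L).
  by apply: measurable_large_sum => i; have [] := z_bounded i.
have h1 : fine (P E1) <= c / 3 by rewrite /E1; near: n.
have h2 : fine (P E2) <= c / 3 by rewrite /E2; near: n.
have h3 := hL n n0.
have mE12 : measurable (E1 `|` E2) by exact: measurableU.
apply: (@le_trans _ _ (fine (P (E1 `|` E2 `|` large_sum Y z n L)))).
  apply: prob_le_sub; last 1 first.
  - move=> w /= eT; apply: contrapT => /not_orP[/not_orP[nE1 nE2] nL].
    suff : `|T n w - oracle n w| < e by rewrite ltNge eT.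
    apply: good => //.
    + move=> s i j; rewrite ltNge; apply/negP => h.
      by apply: nE1; exists (s, i, j).
    + move=> i j; rewrite ltNge; apply/negP => h.
      by apply: nE2; exists (i, j).
    + by move=> i; rewrite ltNge; apply/negP => h; apply: nL; exists i.
  - rewrite -[X in measurable X]setTI; apply: measurable_fun_le => //.
    apply: measurableT_comp => //; apply: measurable_funB => //.
    exact: measurable_oracle.
  - exact: measurableU.
rewrite (le_trans (prob_setU_le P mE12 mE3))//.
by have := prob_setU_le P mE1 mE2; lra.
Unshelve. all: by end_near.
Qed.

Lemma oracle_laplace (k : nat) :
  (fun n => \int[P]_w expR (- (k%:R * oracle n w))) @ \oo -->
  \int[chi_square R N]_x expR (- (k%:R * `|x|)).
Proof.
have mexp : measurable_fun setT (fun x : R => expR (- (k%:R * x))).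
  by apply: measurableT_comp => //; apply: measurableT_comp.
have -> : \int[chi_square R N]_x expR (- (k%:R * `|x|)) = chi_factor k%:R ^+ N.
  by rewrite /Rintegral (chi_square_abs N mexp) chi_square_laplace.
have := laplace_clt Y_indep Y_law z_bounded score_mean0 z_cov score_cov_unit (ler0n R k).
rewrite /gauss_mean (_ : (fun n => _) = (fun n => \int[P]_w expR (- (k%:R * oracle n w))))//.
apply/funext => n; apply: eq_Rintegral => w _; rewrite /oracle.
by rewrite mulrA.
Qed.

Lemma statistic_cvg_mean (f : R -> R) (B : R) : continuous f -> (forall x, `|f x| <= B) ->
  (fun n => \int[P]_w f (T n w)) @ \oo --> \int[chi_square R N]_x f x.
Proof.
move=> cf fB.
apply: (slutsky mT measurable_oracle statistic_close_oracle oracle_tight cf fB).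
have := laplace_determines_law measurable_oracle oracle_ge0 oracle_laplace cf fB.
by rewrite {2}/Rintegral chi_square_abs//; exact: continuous_measurable_fun.
Qed.

End extrinsic_statistic.

Theorem theorem4p1 (R : realType) (m q : nat) (q_ge1 : (1 <= q)%N)
  (disp : measure_display) (Omega : measurableType disp) (P : probability Omega R)
  (* the random sample Y_r = ([X_{r,1}], ..., [X_{r,q}]), r = 0, 1, 2, ... from Q *)
  (Q : probability (q.-tuple (RP R m)) R)
  (Y : nat -> {RV P >-> q.-tuple (RP R m)})
  (Y_law : forall (r : nat) (A : set (q.-tuple (RP R m))), measurable A ->
     distribution P (Y r) A = Q A)
  (Y_indep : mutually_independent Y)
  (X : nat -> 'I_q -> Omega -> 'cV[R]_m.+1)
  (X_unit : forall r s w, dotv (X r s w) (X r s w) = 1)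
  (X_axis : forall r s w, val (tnth (Y r w) s) = axis (X r s w))
  (* eigenvalues and eigenvectors of the second moments *)
  (lam : 'I_q -> 'I_m.+1 -> R) (gam : 'I_q -> 'I_m.+1 -> 'cV[R]_m.+1)
  (lam_gam : forall s, eigensystem (second_moment P (X 0%N s)) (lam s) (gam s))
  (lam_pos : forall s, 0 < lam s ord_max)
  (lam_simple : forall s a, a != ord_max -> lam s a != lam s ord_max)
  (* nondegeneracy: the population counterpart of G is invertible *)
  (cov_nonsingular : extrinsic_cov P (X 0%N) lam gam \in unitmx)
  (* eigenvalues and eigenvectors of the sample second moments *)
  (d : nat -> Omega -> 'I_q -> 'I_m.+1 -> R)
  (g : nat -> Omega -> 'I_q -> 'I_m.+1 -> 'cV[R]_m.+1)
  (d_g : forall n w s,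
     eigensystem (sample_moment n (fun r t => X r t w) s) (d n w s) (g n w s))
  (* choice of signs: for s <> t, G_{(s,a),(t,b)} is odd in g_s(m+1), whereas
     gamma_s^T D_s does not depend on g_s(m+1) *)
  (g_oriented : forall n w s, 0 <= dotv (gam s ord_max) (g n w s ord_max))
  (T : nat -> {RV P >-> R})
  (T_def : forall n w,
     T n w = T2 n (fun r t => X r t w) (d n w) (g n w) (fun s => gam s ord_max)) :
  cvg_in_law T (chi_square R (m * q)).
Proof.
move=> f cf [B fB].
have mf : measurable_fun setT f by exact: continuous_measurable_fun.
have mT n : measurable_fun setT (fun w => T2 n (fun r t => X r t w) (d n w) (g n w)
    (fun s => gam s ord_max)).
  by rewrite (_ : (fun w => _) = T n)//; apply/funext => w; rewrite T_def.
have := statistic_cvg_mean Y_law Y_indep X_unit X_axis lam_gam lam_simple cov_nonsingular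
  d_g g_oriented mT cf fB.
rewrite sum_nat_const card_ord mulnC => cvT.
have b_f d0 (S : measurableType d0) (Z : S -> R) : measurable_fun setT Z ->
    bounded_measurable (fun w => f (Z w)).
  by move=> mZ; apply: (bounded_measurable_comp mf mZ) => w; exact: fB.
have -> : (\int[chi_square R (m * q)]_t (f t)%:E)%E = (\int[chi_square R (m * q)]_t f t)%:E.
  rewrite fineK//; apply: integrable_fin_num => //.
  exact: (bounded_measurable_integrable _ (b_f _ _ _ (@measurable_id _ _ setT))).
have -> : (fun n => (\int[distribution P (T n)]_t (f t)%:E)%E) =
    (fun n => (\int[P]_w f (T2 n (fun r t => X r t w) (d n w) (g n w)
      (fun s => gam s ord_max)))%:E).
  apply/funext => n.
  have iT := bounded_measurable_integrable P (b_f _ _ _ (mT n)).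
  rewrite integral_distribution//; first last.
  - by move: iT; congr (_.-integrable _ _); apply/funext => w /=; rewrite T_def.
  - exact/measurable_EFinP.
  rewrite fineK; last exact: integrable_fin_num.
  by apply: eq_integral => w _ /=; rewrite T_def.
by apply: cvg_EFin => //; exact: nearW.
Qed.
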